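(* Let $n\ge 2$, let $\mathcal{H}=\mathcal{H}_1\otimes\cdots\otimes\mathcal{H}_n$ be an analytic Hilbert module over $\mathbb{C}[z_1,\ldots,z_n]$, and let $\mathcal{Q}$ be a quotient module of $\mathcal{H}$. Then the following conditions are equivalent: (i) $\mathcal{Q}$ is doubly commuting. (ii) $\mathcal{Q}=\mathcal{Q}_1\otimes\cdots\otimes\mathcal{Q}_n$ for some quotient modules $\mathcal{Q}_i$ of $\mathcal{H}_i$, $i=1,\ldots,n$.
   Context: Let $\mathbb{D}$ be the open unit disc in $\mathbb{C}$. A reproducing kernel Hilbert module over $\mathbb{C}[z]$ is a Hilbert space $\mathcal{H}$ of holomorphic functions on $\mathbb{D}$ with bounded point evaluations (hence with a reproducing kernel $K$, $f(w)=\langle f,K(\cdot,w)\rangle$), containing the constant function $1$, on which multiplication by the coordinate, $M_z f=zf$, is a bounded operator $\mathcal{H}\to\mathcal{H}$. A closed subspace $\mathcal{S}\subseteq\mathcal{H}$ is a submodule if $M_z\mathcal{S}\subseteq\mathcal{S}$; a closed subspace $\mathcal{Q}$ is a quotient module if $\mathcal{Q}^\perp$ is a submodule. $\mathcal{H}$ is a standard Hilbert module over $\mathbb{C}[z]$ if there do not exist two non-zero quotient modules of $\mathcal{H}$ orthogonal to each other. A standard Hilbert module over $\mathbb{C}[z_1,\ldots,z_n]$ is a Hilbert space tensor product $\mathcal{H}=\mathcal{H}_1\otimes\cdots\otimes\mathcal{H}_n$ of standard Hilbert modules $\mathcal{H}_i$ over $\mathbb{C}[z]$, with module multiplication operators $M_{z_i}=I_{\mathcal{H}_1}\otimes\cdots\otimes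 M_z\otimes\cdots\otimes I_{\mathcal{H}_n}$ ($M_z$ in the $i$-th place); equivalently it is the reproducing kernel Hilbert space on $\mathbb{D}^n$ with kernel $\prod_{i}K_i(z_i,w_i)$ ($K_i$ the kernel of $\mathcal{H}_i$), with $M_{z_i}$ multiplication by $z_i$. It is an analytic Hilbert module if moreover, for each $i$, $K_i^{-1}(z,w)=1/K_i(z,w)$ is a polynomial in $z$ and $\bar w$. A closed subspace $\mathcal{S}\subseteq\mathcal{H}$ is a submodule if $M_{z_i}\mathcal{S}\subseteq\mathcal{S}$ for all $i$; a closed subspace $\mathcal{Q}$ is a quotient module if $\mathcal{Q}^\perp$ is a submodule. For a quotient module put $C_{z_i}=P_{\mathcal{Q}}M_{z_i}|_{\mathcal{Q}}$, where $P_{\mathcal{Q}}$ is the orthogonal projection onto $\mathcal{Q}$; $\mathcal{Q}$ is doubly commuting if $C_{z_i}C_{z_j}^*=C_{z_j}^*C_{z_i}$ for all $1\le i<j\le n$. *)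

(* Defs.v *)
From HB Require Import structures.
From mathcomp Require Import all_boot all_order all_algebra.
From mathcomp Require Import complex.
From mathcomp Require Import all_classical all_reals all_analysis.

Set Implicit Arguments.
Unset Strict Implicit.
Unset Printing Implicit Defensive.

Import Order.TTheory GRing.Theory Num.Theory.
Import numFieldNormedType.Exports.

Local Open Scope classical_set_scope.
Local Open Scope ring_scope.

(* The inner product is linear in its first argument and conjugate-linear in
   its second; it induces the norm, and the space is complete. *)
Record hilbert (R : realType) := Hilbert {
  hspace :> completeNormedModType R[i];
  dot : {dot hspace for Num.conj};
  dotE : forall f : hspace, dot f f = `|f| ^+ 2
}.
Arguments dot {R h}.

Section Subspaces.
Context {R : realType} {H : hilbert R}.

Definition closed_subspace (S : set H) : Prop :=
  [/\ closed S, S 0 & forall (a : R[i]) f g, S f -> S g -> S (a *: f + g)].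

Definition perp (S : set H) : set H :=
  [set f | forall g, S g -> dot f g = 0].

(* Modules are given by a family M of multiplication operators, indexed by
   unit in one variable and by 'I_n in n variables. *)
Definition submodule (I : Type) (M : I -> H -> H) (S : set H) : Prop :=
  closed_subspace S /\ forall i f, S f -> S (M i f).

Definition quotient_module (I : Type) (M : I -> H -> H) (Q : set H) : Prop :=
  closed_subspace Q /\ submodule M (perp Q).

(* For a closed subspace Q, the point defining orth_proj Q f exists and is unique;
   likewise below for the adjoint of a bounded operator on Q. *)
Definition orth_proj (Q : set H) (f : H) : H :=
  get [set g | Q g /\ perp Q (f - g)].

(* P_Q T|_Q; only its values on Q are meaningful. *)
Definition compression (Q : set H) (T : H -> H) : H -> H :=
  fun f => orth_proj Q (T f).

(* Adjoint of an operator T : Q -> Q in the Hilbert space Q. *)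
Definition adjoint_on (Q : set H) (T : H -> H) (g : H) : H :=
  get [set h | Q h /\ forall f, Q f -> dot (T f) g = dot f h].

Definition doubly_commuting (n : nat) (M : 'I_n -> H -> H) (Q : set H) : Prop :=
  let C i := compression Q (M i) in
  forall i j : 'I_n, (i < j)%N -> forall f, Q f ->
    C i (adjoint_on Q (C j) f) = adjoint_on Q (C j) (C i f).

End Subspaces.

(* ev z f is the value of the function f at z.  Only the points z of the open
   unit disc are constrained; by ev_inj an element of the space is determined
   by its values there.  derivable over the field R[i] is complex
   differentiability. *)
Record rkh_module (R : realType) := RKHModule {
  rkh_space :> hilbert R;
  ev : R[i] -> {linear rkh_space -> R[i]^o};
  ev_inj : forall f : rkh_space,
    (forall z : R[i], `|z| < 1 -> ev z f = 0) -> f = 0;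
  ev_holo : forall (f : rkh_space) (z : R[i]), `|z| < 1 ->
    derivable (fun w : R[i]^o => ev w f : R[i]^o) z 1;
  ev_bounded : forall z : R[i], `|z| < 1 -> continuous (ev z);
  rkh_one : rkh_space;
  rkh_oneE : forall z : R[i], `|z| < 1 -> ev z rkh_one = 1;
  mulz : {linear rkh_space -> rkh_space};
  mulzE : forall (f : rkh_space) (z : R[i]), `|z| < 1 ->
    ev z (mulz f) = z * ev z f;
  mulz_bounded : continuous mulz
}.
Arguments ev {R} r z.
Arguments mulz {R} r.

Section OneVariable.
Context {R : realType} (H : rkh_module R).

(* K(., w) for w in the disc, the Riesz representative of evaluation at w. *)
Definition kernel_at (w : R[i]) : H :=
  get [set k : H | forall f : H, ev H w f = dot f k].

Definition repro_kernel (z w : R[i]) : R[i] := ev H z (kernel_at w).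

Definition quotient_module1 : set H -> Prop :=
  quotient_module (fun _ : unit => mulz H).

Definition standard : Prop :=
  ~ exists Q1 Q2 : set H,
    [/\ quotient_module1 Q1, quotient_module1 Q2,
        Q1 <> [set 0], Q2 <> [set 0] &
        forall f g, Q1 f -> Q2 g -> dot f g = 0].

Definition polynomial_inverse_kernel : Prop :=
  exists p : {poly {poly R[i]}}, forall z w : R[i], `|z| < 1 -> `|w| < 1 ->
    repro_kernel z w != 0 /\ (repro_kernel z w)^-1 = p.[z, w^*].

End OneVariable.
Arguments quotient_module1 {R H} _.

(* A Hilbert space tensor product of the Hs i, up to unitary equivalence:
   elementary tensors are multilinear, have the product inner products and
   span a dense subspace.  dfwith f i x replaces the i-th entry of f by x : Hs i,
   so tensor_mul i is I (x) ... (x) M_z (x) ... (x) I, which is determined by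
   its values on elementary tensors. *)
Record tensor_product (R : realType) (n : nat) (Hs : 'I_n -> rkh_module R) :=
  TensorProduct {
  tensor_space :> hilbert R;
  tensor : (forall i, Hs i) -> tensor_space;
  tensor_linear : forall (f : forall i, Hs i) (i : 'I_n) (a : R[i])
      (x y : Hs i),
    tensor (dfwith f i (a *: x + y)) =
    a *: tensor (dfwith f i x) + tensor (dfwith f i y);
  tensor_dot : forall f g : (forall i, Hs i),
    dot (tensor f) (tensor g) = \prod_(i < n) dot (f i) (g i);
  tensor_dense : smallest closed_subspace (range tensor) = setT;
  tensor_mul : 'I_n -> {linear tensor_space -> tensor_space};
  tensor_mulE : forall (i : 'I_n) (f : forall i, Hs i),
    tensor_mul i (tensor f) = tensor (dfwith f i (mulz (Hs i) (f i)));
  tensor_mul_bounded : forall i, continuous (tensor_mul i)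
}.
Arguments tensor {R n Hs} t f.
Arguments tensor_mul {R n Hs} t i.

Section SeveralVariables.
Context {R : realType} {n : nat} {Hs : 'I_n -> rkh_module R}.

Definition analytic_module (H : tensor_product Hs) : Prop :=
  forall i, standard (Hs i) /\ polynomial_inverse_kernel (Hs i).

(* Q_1 (x) ... (x) Q_n, as a closed subspace of the tensor product. *)
Definition tensor_subspace (H : tensor_product Hs)
    (Qs : forall i, set (Hs i)) : set H :=
  smallest closed_subspace
    [set tensor H f | f in [set f | forall i, Qs i (f i)]].

End SeveralVariables.
Arguments tensor_subspace {R n Hs} H Qs.

(* Main.v *)
Require Import Defs.
From HB Require Import structures.
From mathcomp Require Import all_boot all_order all_algebra.
From mathcomp Require Import complex ring.
From mathcomp Require Import all_classical all_reals all_analysis.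

Set Implicit Arguments.
Unset Strict Implicit.
Unset Printing Implicit Defensive.

Import Order.TTheory GRing.Theory Num.Theory.
Import numFieldNormedType.Exports.

Local Open Scope classical_set_scope.
Local Open Scope ring_scope.

(** Write M_i for the multiplication operators, M_i^* for their adjoints and P
    for the orthogonal projection onto Q.  The space Q is invariant under every
    M_i^*, so P M_i = P M_i P.

    One variable.  If the inverse kernel is the polynomial with coefficients
    a_kl, then the sum of the a_kl M^k M^*^l is the rank one operator
    f |-> <f, 1> 1: both sides agree on kernel functions, which are eigenvectors
    of M^* ([her_kernel_one]).  The constant function 1 may fail to be a cyclic
    vector of M, but standardness makes every eigenvector of M^* cyclic
    ([standard_eigenvector_cyclic]).  So whenever a polynomial expression
    p(M, M^* ) is the rank one operator f |-> <f, h> g and h is not cyclic, M^*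
    has an eigenvector orthogonal to the orbit of h, its eigenvalue is a root of
    p in the variable of M^*, and the corresponding linear factor can be divided
    out ([hereditary_descent]).  Doing this for h and then for g yields a rank
    one p(M, M^* ) with both g and h cyclic ([hereditary_rank_one]).

    From doubly commuting to a tensor product.  For a set A of indices let
    [reach A] be the smallest closed subspace that contains Q and is invariant
    under M_j for j in A.  Double commutation yields <P F, G> = <F, G> for F in
    [reach {i}] and G in the [reach] of the complement of {i}, hence these two
    spaces meet in Q only ([reach_cap]).  On the other hand the operator of rank
    one x |-> <x, v> u, acting on the j-th factor, is a limit of combinations of
    the M_j^k p(M_j, M_j^* ) M_j^*^l and therefore maps [reach A] into
    [reach (A + j)] for j outside A ([reach_rank1]).  Let Q_i be the closed span
    of the slices of Q in the i-th factor.  Using the rank one operators of all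
    the factors but the i-th, every elementary tensor with i-th entry in Q_i
    lies in the [reach] of the complement of {i} ([reach_slice]).  Consequently
    x |-> <x, v> u on the i-th factor maps Q to Q as soon as u belongs to Q_i
    ([rank1_Q]).  Applying this in every factor to one F in Q gives
    <F, v_1 (x) .. (x) v_n> u_1 (x) .. (x) u_n, so Q contains the tensor product
    of the Q_i ([ten_slice]).  The opposite inclusion follows from the
    definition of slices ([doubly_commuting_tensor]).

    Conversely, the projection onto a tensor product of closed subspaces acts
    factor by factor ([orth_proj_ten]), and operators acting on different
    factors commute. *)

(** * Bounded operators and closed subspaces *)

Section linear.
Variables (K : pzRingType) (V W : lmodType K) (T : V -> W).
Hypothesis lT : linear T.
Lemma lin0 : T 0 = 0.
Proof. by have := lT (-1) 0 0; rewrite scaler0 addr0 scaleN1r addNr. Qed.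
Lemma linZ a f : T (a *: f) = a *: T f.
Proof. by have := lT a f 0; rewrite lin0 !addr0. Qed.
Lemma linD f g : T (f + g) = T f + T g.
Proof. by have := lT 1 f g; rewrite !scale1r. Qed.
Lemma linB f g : T (f - g) = T f - T g.
Proof. by rewrite -scaleN1r linD linZ scaleN1r. Qed.
Lemma lin_sum I (r : seq I) (P : pred I) (F : I -> V) :
  T (\sum_(i <- r | P i) F i) = \sum_(i <- r | P i) T (F i).
Proof. by apply: (big_morph T linD lin0). Qed.
End linear.

Section Hilbert.
Context {R : realType}.
Local Notation C := R[i].
Implicit Types H : hilbert R.

Lemma dotC H (f g : H) : dot f g = (dot g f)^*.
Proof. by rewrite hermC expr0 mul1r. Qed.

Lemma dotDl H (f g h : H) : dot (f + g) h = dot f h + dot g h.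
Proof. exact: linearDl. Qed.
Lemma dotDr H (f g h : H) : dot h (f + g) = dot h f + dot h g.
Proof. exact: linearDr. Qed.
Lemma dotZl H (a : C) (f h : H) : dot (a *: f) h = a * dot f h.
Proof. exact: linearZl_LR. Qed.
Lemma dotZr H (a : C) (f h : H) : dot h (a *: f) = a^* * dot h f.
Proof. exact: linearZr_LR. Qed.
Lemma dotBl H (f g h : H) : dot (f - g) h = dot f h - dot g h.
Proof. exact: linearBl. Qed.
Lemma dotBr H (f g h : H) : dot h (f - g) = dot h f - dot h g.
Proof. exact: linearBr. Qed.
Lemma dot0l H (h : H) : dot 0 h = 0.
Proof. exact: linear0l. Qed.
Lemma dot0r H (h : H) : dot h 0 = 0.
Proof. exact: linear0r. Qed.

Lemma dot_eq0 H (f : H) : (dot f f == 0) = (f == 0).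
Proof. by rewrite dotE expf_eq0 /= normr_eq0. Qed.

Lemma dot_inj H (f g : H) : (forall h, dot h f = dot h g) -> f = g.
Proof.
move=> e; apply/eqP; rewrite -subr_eq0 -dot_eq0 dotBr.
by rewrite e subrr.
Qed.

Lemma Cauchy_Schwarz H (f g : H) : `|dot f g| <= `|f| * `|g|.
Proof.
have [->|g0] := eqVneq g 0; first by rewrite dot0r !normr0 mulr0.
have ng : 0 < `|g| by rewrite normr_gt0.
rewrite -(@ler_pXn2r _ 2)// ?nnegrE ?mulr_ge0// exprMn.
set a := dot f g / `|g| ^+ 2.
have : 0 <= dot (f - a *: g) (f - a *: g) by rewrite dotE exprn_ge0.
have rg : (`|g| ^+ 2)^* = `|g| ^+ 2 by rewrite conj_Creal// rpredX// normr_real.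
rewrite dotBl !dotBr !dotZl !dotZr !dotE.
have -> : a^* = (dot f g)^* / `|g| ^+ 2.
  by rewrite rmorphM fmorphV/= rg.
rewrite [dot g f]dotC /a normCK.
set x := dot f g; set y := `|g| ^+ 2.
have y0 : 0 < y by rewrite exprn_gt0.
have -> : `|f| ^+ 2 - x^* / y * x - (x / y * x^* - x / y * (x^* / y * y)) =
  (`|f|^+2 * y - x * x^*) / y.
  rewrite divfK ?gt_eqF// subrr subr0 mulrBl mulfK ?gt_eqF//.
  by rewrite mulrAC [x^* * x]mulrC.
by rewrite pmulr_lge0 ?invr_gt0// subr_ge0.
Qed.

Lemma lipschitz_cont (V W : normedModType C) (T : V -> W) (c : C) :
  (forall f g, `|T f - T g| <= c * `|f - g|) -> continuous T.
Proof.
move=> Tc f; apply/cvgrPdist_lt => e e0.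
have c1 : 0 < `|c| + 1 by rewrite ltr_wpDl.
near=> g; apply: le_lt_trans (Tc f g) _.
have fg : `|f - g| < e / (`|c| + 1).
  by near: g; apply: cvgr_dist_lt => //; rewrite divr_gt0.
rewrite ltr_pdivlMr// in fg.
apply: le_lt_trans fg; rewrite mulrC.
have [->|nfg] := eqVneq `|f - g| 0; first by rewrite !mul0r.
have pfg : 0 < `|f - g| by rewrite lt_def nfg normr_ge0.
rewrite ler_pM2l//.
have cr : c \is Num.real.
  have := le_trans (normr_ge0 _) (Tc f g).
  by rewrite pmulr_lge0// => /ger0_real.
by rewrite (le_trans (real_ler_norm cr))// lerDl.
Unshelve. all: by end_near. Qed.

(** Operators are plain functions with a property, so that iterates, sums and
    adjoints can be formed without building structures. *)
Definition bounded_op (V W : normedModType C) (T : V -> W) :=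
  linear T /\ exists c, forall f, `|T f| <= c * `|f|.

Lemma bop_cont (V W : normedModType C) (T : V -> W) : bounded_op T -> continuous T.
Proof.
by move=> [lT [c Tc]]; apply: (@lipschitz_cont _ _ _ c) => f g; rewrite -linB.
Qed.

Lemma bop_of_cont (V W : normedModType C) (T : {linear V -> W}) :
  continuous T -> bounded_op T.
Proof.
move=> /linear_bounded_continuous/linear_boundedP/pinfty_ex_gt0 [r r0 Tr].
by split; [exact: linearP|exists r].
Qed.

Lemma bop_comp (U V W : normedModType C) (S : V -> W) (T : U -> V) :
  bounded_op S -> bounded_op T -> bounded_op (S \o T).
Proof.
move=> [lS [c Sc]] [lT [d Td]]; split.
  by move=> a f g /=; rewrite lT lS.
exists (`|c| * d) => f /=.
have [Tf0|Tf0] := eqVneq (T f) 0.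
  rewrite Tf0 (lin0 lS) normr0 -mulrA mulr_ge0//.
  exact: le_trans (normr_ge0 _) (Td f).
have cr : c \is Num.real.
  have := le_trans (normr_ge0 _) (Sc (T f)).
  by rewrite pmulr_lge0 ?normr_gt0// => /ger0_real.
apply: le_trans (Sc _) _; rewrite -mulrA.
by apply: le_trans (ler_wpM2l (normr_ge0 _) (Td f)); rewrite ler_wpM2r// real_ler_norm.
Qed.

Lemma bop_id (V : normedModType C) : bounded_op (@id V).
Proof. by split=> //; exists 1 => f; rewrite mul1r. Qed.

Lemma bop_real (V W : normedModType C) (T : V -> W) : bounded_op T ->
  exists2 c, 0 <= c & forall f, `|T f| <= c * `|f|.
Proof.
move=> [lT [c Tc]]; exists `|c| => // f.
have [->|f0] := eqVneq f 0; first by rewrite (lin0 lT) !normr0 mulr0.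
apply: le_trans (Tc f) _; rewrite ler_wpM2r// real_ler_norm//.
have := le_trans (normr_ge0 _) (Tc f).
by rewrite pmulr_lge0 ?normr_gt0// => /ger0_real.
Qed.

Lemma bop_add (V W : normedModType C) (S T : V -> W) a :
  bounded_op S -> bounded_op T -> bounded_op (fun f => a *: S f + T f).
Proof.
move=> bS bT; have [c c0 Sc] := bop_real bS; have [d d0 Td] := bop_real bT.
have [lS _] := bS; have [lT _] := bT; split.
  move=> b f g; rewrite lS lT !scalerDr !scalerA [a * b]mulrC.
  by rewrite addrACA.
exists (`|a| * c + d) => f; apply: le_trans (ler_normD _ _) _.
by rewrite normrZ mulrDl -mulrA lerD// ler_wpM2l.
Qed.

Lemma bop_0 (V W : normedModType C) : bounded_op (fun _ : V => 0 : W).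
Proof.
by split=> [a f g|]; rewrite ?scaler0 ?addr0//; exists 0 => f; rewrite normr0 mul0r.
Qed.

Lemma bop_scale (V W : normedModType C) (S : V -> W) a :
  bounded_op S -> bounded_op (fun f => a *: S f).
Proof.
move=> bS; have := bop_add a bS (@bop_0 V W).
by congr bounded_op; apply/funext => f; rewrite addr0.
Qed.

Lemma bop_sum (V W : normedModType C) I (r : seq I) (P : pred I) (F : I -> V -> W) :
  (forall i, bounded_op (F i)) -> bounded_op (fun f => \sum_(i <- r | P i) F i f).
Proof.
move=> bF; elim: r => [|i r IH].
  by under eq_fun do rewrite big_nil; exact: bop_0.
under eq_fun do rewrite big_cons.
case: (P i) => //; have := bop_add 1 (bF i) IH.
by congr bounded_op; apply/funext => f; rewrite scale1r.
Qed.

Lemma closed_subspaceD H (S : set H) f g : closed_subspace S -> S f -> S g -> S (f + g).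
Proof. by move=> [_ _ cS] Sf Sg; rewrite -[f]scale1r; apply: cS. Qed.
Lemma closed_subspaceZ H (S : set H) a f : closed_subspace S -> S f -> S (a *: f).
Proof. by move=> [_ S0 cS] Sf; rewrite -[_ *: _]addr0; apply: cS. Qed.
Lemma closed_subspaceB H (S : set H) f g : closed_subspace S -> S f -> S g -> S (f - g).
Proof.
move=> cS Sf Sg; apply: closed_subspaceD => //.
by rewrite -scaleN1r; apply: closed_subspaceZ.
Qed.
Lemma closed_subspace_sum H (S : set H) I (r : seq I) (P : pred I) (F : I -> H) :
  closed_subspace S -> (forall i, P i -> S (F i)) -> S (\sum_(i <- r | P i) F i).
Proof.
move=> cS SF; apply: big_ind => //; first by case: cS.
by move=> f g; apply: closed_subspaceD.
Qed.

Lemma closed_subspace_preimage H H' (T : H -> H') (S : set H') :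
  bounded_op T -> closed_subspace S -> closed_subspace [set f | S (T f)].
Proof.
move=> bT [cS S0 lS]; have [lT _] := bT; split => /=.
- by apply: (@preimage_closed _ _ T) => // f _; exact: bop_cont.
- by rewrite (lin0 lT).
- by move=> a f g Sf Sg; rewrite lT; exact: lS.
Qed.

Lemma closed_subspace_bigI H (I : Type) (D : set I) (S : I -> set H) :
  (forall i, D i -> closed_subspace (S i)) -> closed_subspace (\bigcap_(i in D) S i).
Proof.
move=> cS; split.
- by apply: closed_bigI => i /cS[].
- by move=> i /cS[].
- by move=> a f g Sf Sg i Di; have [_ _] := cS _ Di; apply; [exact: Sf|exact: Sg].
Qed.

Lemma closed_subspace0 H : closed_subspace [set (0 : H)].
Proof.
split => //; first by apply: accessible_closed_set1; apply: hausdorff_accessible;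
  apply: norm_hausdorff.
by move=> a f g -> ->; rewrite scaler0 addr0.
Qed.

Lemma closed_subspace_eq H H' (S T : H -> H') :
  bounded_op S -> bounded_op T -> closed_subspace [set f | S f = T f].
Proof.
move=> bS bT.
have -> : [set f | S f = T f] = [set f | [set 0] ((-1) *: T f + S f)].
  apply/seteqP; split => f /= E.
    by rewrite E scaleN1r addNr.
  by move/eqP: E; rewrite scaleN1r addrC subr_eq0 => /eqP.
by apply: (closed_subspace_preimage (bop_add _ bT bS)); exact: closed_subspace0.
Qed.

Lemma closed_subspace_dotl H (g : H) : closed_subspace [set f | dot f g = 0].
Proof.
split => /=.
- apply: (@preimage_closed _ C^o (fun f => dot f g) [set 0]).
  + by move=> f _; apply: (@lipschitz_cont H C^o _ `|g|) => f1 f2;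
      rewrite -dotBl mulrC; exact: Cauchy_Schwarz.
  + by apply: accessible_closed_set1; apply: hausdorff_accessible;
      apply: norm_hausdorff.
- by rewrite dot0l.
- by move=> a f f' Sf Sg; rewrite dotDl dotZl Sf Sg mulr0 addr0.
Qed.

Lemma closed_subspace_perp H (S : set H) : closed_subspace (perp S).
Proof.
have -> : perp S = \bigcap_(g in S) [set f | dot f g = 0] by [].
by apply: closed_subspace_bigI => g _; exact: closed_subspace_dotl.
Qed.

Lemma perpS H (S T : set H) : S `<=` T -> perp T `<=` perp S.
Proof. by move=> ST f Tf g /ST; exact: Tf. Qed.

Lemma dotC0 H (f g : H) : dot f g = 0 -> dot g f = 0.
Proof. by move=> E; rewrite dotC E rmorph0. Qed.

Lemma closed_subspace_dotr H (g : H) : closed_subspace [set f | dot g f = 0].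
Proof.
have -> : [set f | dot g f = 0] = [set f | dot f g = 0].
  by apply/seteqP; split => f /=; apply: dotC0.
exact: closed_subspace_dotl.
Qed.

Local Notation span := (smallest (@closed_subspace R _)).

Lemma closed_subspace_span H (G : set H) : closed_subspace (span G).
Proof. by apply: closed_subspace_bigI => S []. Qed.

Lemma span_ind H (G S : set H) : closed_subspace S -> G `<=` S -> span G `<=` S.
Proof. by move=> cS GS; apply: smallest_sub. Qed.

Lemma sub_span H (G : set H) : G `<=` span G.
Proof. exact: sub_smallest. Qed.

End Hilbert.

(** * Orthogonal projections, Riesz representation and adjoints *)

Section Proj.
Context {R : realType}.
Local Notation C := R[i].
Implicit Types H : hilbert R.

Lemma parallelogram H (f g : H) :
  `|f + g| ^+ 2 + `|f - g| ^+ 2 = 2 * (`|f| ^+ 2 + `|g| ^+ 2).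
Proof.
rewrite -!dotE dotBl !dotBr dotDl !dotDr mulr_natl mulr2n.
ring.
Qed.

Lemma lec_addgt0 (x y : C) : 0 <= x -> 0 <= y ->
  (forall e : C, 0 < e -> x <= y + e) -> x <= y.
Proof.
move=> x0 y0 xy; have [//|yx] := real_leP (ger0_real x0) (ger0_real y0).
have := xy ((x - y) / 2); rewrite divr_gt0 ?subr_gt0// => /(_ isT).
rewrite -lerBlDl ler_pdivlMr// -subr_ge0 mulr_natr mulr2n opprD addrA subrr add0r.
by rewrite oppr_ge0 subr_le0 => /(lt_le_trans yx); rewrite ltxx.
Qed.

(** The vectors of S whose squared distance to f is within e of the infimum
    generate a Cauchy filter, by the parallelogram law; its limit is the
    projection of f. *)
Lemma projection_theorem H (S : set H) (f : H) :
  closed_subspace S -> exists g, S g /\ perp S (f - g).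
Proof.
move=> cS; have [clS S0 lS] := cS.
pose N (h : H) : R := complex.Re (`|h| ^+ 2).
have NE h : (N h)%:C%C = `|h| ^+ 2.
  by apply: RRe_real; rewrite rpredX// normr_real.
pose E := [set N (f - s) | s in S].
have iE : has_inf E.
  split; first by exists (N (f - 0)), 0.
  by exists 0 => _ [s _ <-]; rewrite -lecR NE exprn_ge0.
pose d := inf E.
have dle s : S s -> d%:C%C <= `|f - s| ^+ 2.
  move=> Ss; rewrite -NE lecR; apply: ge_inf; first by case: iE.
  by exists s.
pose A (e : C) := [set s | S s /\ `|f - s| ^+ 2 < d%:C%C + e].
have A0 e : 0 < e -> A e !=set0.
  move=> e0; have e0' : 0 < complex.Re e by move: e0; rewrite ltcE => /andP[].
  have [_ [s Ss <-] sd] := inf_adherent e0' iE.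
  exists s; split => //; rewrite -NE -[e]RRe_real ?gtr0_real//.
  by rewrite -rmorphD ltcR.
(* The midpoint of s and t is at squared distance at least d from f, so the
   parallelogram law bounds the distance from s to t. *)
have Ad e s t : A e s -> A e t -> `|s - t| ^+ 2 < 4 * e.
  move=> [Ss se] [St te].
  have := parallelogram (f - s) (f - t).
  have -> : f - s - (f - t) = t - s by rewrite opprB addrC addrA subrK.
  have -> : f - s + (f - t) = (2 : C) *: (f - (2 : C)^-1 *: (s + t)).
    rewrite scalerBr scalerA divff ?pnatr_eq0// scale1r scaler_nat mulr2n.
    by rewrite opprD addrACA.
  have : d%:C%C <= `|f - (2 : C)^-1 *: (s + t)| ^+ 2.
    by apply: dle; apply: closed_subspaceZ => //; apply: closed_subspaceD.
  rewrite normrZ exprMn [`|t - s|]distrC.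
  set x := `|f - s| ^+ 2 in se *; set y := `|f - t| ^+ 2 in te *.
  set z := `|f - _| ^+ 2 => dz.
  set w := `|s - t| ^+ 2.
  rewrite [`|2 : C|]ger0_norm// => par.
  have -> : w = 2 * (x + y) - 4 * z by rewrite -par; ring.
  rewrite ltrBlDr.
  apply: (@lt_le_trans _ _ (2 * (d%:C%C + e + (d%:C%C + e)))).
    by rewrite ltr_pM2l// ltrD.
  have -> : 2 * (d%:C%C + e + (d%:C%C + e)) = 4 * e + 4 * d%:C%C.
    by ring.
  by rewrite lerD2l ler_pM2l.
pose F : set_system H := filter_from [set e : C | 0 < e] A.
have FF : ProperFilter F.
  apply: filter_from_proper; last by move=> e; exact: A0.
  apply: filter_from_filter; first by exists 1 => /=.
  move=> e1 e2 e10 e20.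
  have [le|le] := real_leP (gtr0_real e10) (gtr0_real e20).
    exists e1 => // s [Ss se]; split; split => //.
    by apply: lt_le_trans se _; rewrite lerD2l.
  exists e2 => // s [Ss se]; split; split => //.
  by apply: lt_le_trans se _; rewrite lerD2l ltW.
have : cvg F.
  apply/cauchy_cvgP; apply: cauchy_exP => e e0.
  pose r := e ^+ 2 / 4.
  have r0 : 0 < r by rewrite divr_gt0// exprn_gt0.
  have [s As] := A0 _ r0; exists s; exists r => // t At.
  rewrite -ball_normE /= -(@ltr_pXn2r _ 2)// ?nnegrE ?(ltW e0)//.
  apply: lt_le_trans (Ad _ _ _ As At) _.
  by rewrite /r mulrCA divff ?pnatr_eq0// mulr1.
move=> /cvg_ex [g /= Fg].
have near_g e1 e2 : 0 < e1 -> 0 < e2 -> exists2 s, A e1 s & `|g - s| < e2.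
  move=> e10 e20; have : F (ball g e2) by apply: Fg; exact: nbhsx_ballx.
  move=> [r /= r0 rg].
  have [m [m0 mr me]] : exists m : C, [/\ 0 < m, m <= r & m <= e1].
    have [re|/ltW er] := real_leP (gtr0_real r0) (gtr0_real e10).
      by exists r.
    by exists e1.
  have [s [Ss sm]] := A0 _ m0; exists s.
    by split => //; apply: lt_le_trans sm _; rewrite lerD2l.
  have : A r s by split => //; apply: lt_le_trans sm _; rewrite lerD2l.
  by move=> /rg; rewrite -ball_normE.
exists g; split.
  rewrite (iffLR (closure_id _) clS) => B /nbhs_ballP [e e0 eB].
  have [s [Ss _] gs] := near_g _ _ e0 e0; exists s; split => //.
  by apply: eB; rewrite -ball_normE.
(* Moving s by the multiple of h that decreases the distance to f the most
   cannot gain more than e. *)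
move=> h Sh.
have var e s : 0 < e -> A e s -> `|dot (f - s) h| ^+ 2 <= e * `|h| ^+ 2.
  move=> e0 [Ss se]; have [->|h0] := eqVneq h 0.
    by rewrite dot0r !normr0 expr0n /= mulr0.
  have nh : 0 < `|h| ^+ 2 by rewrite exprn_gt0// normr_gt0.
  set x := dot (f - s) h.
  have : d%:C%C <= `|f - s - (x / `|h| ^+ 2) *: h| ^+ 2.
    by rewrite -addrA -opprD; apply: dle; rewrite addrC; apply: lS.
  have -> : `|f - s - (x / `|h| ^+ 2) *: h| ^+ 2 =
            `|f - s| ^+ 2 - `|x| ^+ 2 / `|h| ^+ 2.
    move: (f - s) @x => u x; rewrite -[LHS]dotE [LHS]dotBl !dotBr !dotZl.
    rewrite !dotZr !dotE [dot h u]dotC -/x.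
    have -> : (x / `|h| ^+ 2)^* = x^* / `|h| ^+ 2.
      by rewrite rmorphM fmorphV/= [X in _ / X]conj_Creal// rpredX// normr_real.
    by rewrite normCK; field; rewrite normr_eq0.
  rewrite lerBrDr addrC -lerBrDr => xd; rewrite -ler_pdivrMr//.
  by rewrite (le_trans xd)// lerBlDl ltW.
apply/eqP; rewrite -normr_le0; apply: lec_addgt0 => // e e0; rewrite add0r.
have h1 : 0 < 2 * (`|h| + 1) by rewrite mulr_gt0// ltr_wpDl.
pose r := e / (2 * (`|h| + 1)).
have r0 : 0 < r by rewrite divr_gt0.
have [s As gs] := near_g (r ^+ 2) r (exprn_gt0 _ r0) r0.
have -> : f - g = f - s - (g - s) by rewrite opprB addrA subrK.
rewrite dotBl (le_trans (ler_normB _ _))//.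
have -> : e = r * (`|h| + 1) + r * (`|h| + 1).
  by rewrite /r; field; rewrite gt_eqF// ltr_wpDl.
clearbody r; have r1 := ltW r0.
have rh : r * `|h| <= r * (`|h| + 1) by rewrite ler_pM2l// lerDl.
rewrite lerD//.
  rewrite (le_trans _ rh)// -(@ler_pXn2r _ 2)// ?nnegrE ?mulr_ge0//.
  by rewrite exprMn var// exprn_gt0.
rewrite (le_trans _ rh)// (le_trans (Cauchy_Schwarz _ _))//.
by rewrite ler_wpM2r// ltW.
Qed.
End Proj.

Section Riesz.
Context {R : realType}.
Local Notation C := R[i].
Implicit Types H : hilbert R.

Local Notation span := (smallest (@closed_subspace R _)).

Lemma sub_perp_perp H (S : set H) : S `<=` perp (perp S).
Proof. by move=> f Sf g Pg; apply: dotC0; exact: Pg. Qed.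

Lemma perp_perp H (S : set H) : closed_subspace S -> perp (perp S) = S.
Proof.
move=> cS; apply/seteqP; split; last exact: sub_perp_perp.
move=> f PPf; have [g [Sg Pfg]] := projection_theorem f cS.
suff : f - g = 0 by move/eqP; rewrite subr_eq0 => /eqP ->.
apply/eqP; rewrite -dot_eq0; apply/eqP.
by rewrite dotBl PPf// [X in _ - X]dotC Pfg// rmorph0 subrr.
Qed.

Lemma perp_span H (G : set H) : perp (span G) = perp G.
Proof.
apply/seteqP; split; first by apply: perpS; exact: sub_span.
move=> f Pf g; move: g; apply: span_ind; first exact: closed_subspace_dotr.
by move=> g /= Gg; exact: Pf.
Qed.

Lemma span_perp0 H (G : set H) :
  (forall f, perp G f -> f = 0) -> span G = setT.
Proof.
move=> G0; rewrite -[span G]perp_perp; last exact: closed_subspace_span.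
by rewrite perp_span; apply/seteqP; split => // f _ g /G0 ->; rewrite dot0r.
Qed.

Lemma orth_projP H (Q : set H) f : closed_subspace Q ->
  Q (orth_proj Q f) /\ perp Q (f - orth_proj Q f).
Proof. by move=> cQ; apply: (getPex (projection_theorem f cQ)). Qed.

Lemma orth_proj_unique H (Q : set H) f g : closed_subspace Q ->
  Q g -> perp Q (f - g) -> orth_proj Q f = g.
Proof.
move=> cQ Qg Pg; have [Qp Pp] := orth_projP f cQ.
apply/eqP; rewrite -subr_eq0 -dot_eq0.
have Qpg := closed_subspaceB cQ Qp Qg.
suff : perp Q (orth_proj Q f - g) by move=> ->.
have -> : orth_proj Q f - g = (f - g) - (f - orth_proj Q f).
  by rewrite opprB [RHS]addrC addrA subrK.
by apply: (closed_subspaceB (closed_subspace_perp _)) => //.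
Qed.

Lemma orth_proj_id H (Q : set H) f : closed_subspace Q -> Q f -> orth_proj Q f = f.
Proof.
by move=> cQ Qf; apply: orth_proj_unique => //; rewrite subrr => g _; rewrite dot0l.
Qed.

Lemma orth_proj_dotl H (Q : set H) f g : closed_subspace Q -> Q g ->
  dot (orth_proj Q f) g = dot f g.
Proof.
move=> cQ Qg; have [_ Pp] := orth_projP f cQ.
by apply/eqP; rewrite eq_sym -subr_eq0 -dotBl Pp.
Qed.

Lemma orth_proj_sa H (Q : set H) f g : closed_subspace Q ->
  dot (orth_proj Q f) g = dot f (orth_proj Q g).
Proof.
move=> cQ; have [Qf _] := orth_projP f cQ; have [Qg _] := orth_projP g cQ.
by rewrite dotC -(orth_proj_dotl g cQ Qf) -dotC orth_proj_dotl.
Qed.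

Lemma orth_proj_norm H (Q : set H) f : closed_subspace Q ->
  `|orth_proj Q f| <= `|f|.
Proof.
move=> cQ; have [Qf Pf] := orth_projP f cQ.
have [->|n0] := eqVneq (orth_proj Q f) 0; first by rewrite normr0.
have n1 : 0 < `|orth_proj Q f| by rewrite normr_gt0.
rewrite -(ler_pM2r n1) -expr2 -dotE orth_proj_dotl//.
have := Cauchy_Schwarz f (orth_proj Q f).
rewrite -(orth_proj_dotl f cQ Qf) dotE ger0_norm// exprn_ge0//.
Qed.

Lemma orth_proj_bop H (Q : set H) : closed_subspace Q -> bounded_op (orth_proj Q).
Proof.
move=> cQ; split; last by exists 1 => f; rewrite mul1r orth_proj_norm.
move=> a f g; have [Qf Pf] := orth_projP f cQ; have [Qg Pg] := orth_projP g cQ.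
have [_ _ lQ] := cQ; have [_ _ lP] := closed_subspace_perp Q.
apply: orth_proj_unique => //; first exact: lQ.
have -> : a *: f + g - (a *: orth_proj Q f + orth_proj Q g) =
  a *: (f - orth_proj Q f) + (g - orth_proj Q g).
  by rewrite scalerBr opprD addrACA.
exact: lP.
Qed.

(** The representing vector is orthogonal to the kernel of the functional, so
    it is found by projecting some f with phi f != 0. *)
Lemma Riesz H (phi : H -> C^o) : bounded_op phi -> exists k, forall f, phi f = dot f k.
Proof.
move=> bphi; have [lphi _] := bphi.
have [all0|/existsNP[f /eqP nf]] := pselect (forall f, phi f = 0).
  by exists 0 => f; rewrite all0 dot0r.
pose Z := [set f | phi f = 0].
have cZ : closed_subspace Z.
  split => /=.
  - apply: (@preimage_closed _ _ phi [set 0]).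
      by move=> g _; exact: bop_cont.
    by apply: accessible_closed_set1; apply: hausdorff_accessible;
      apply: norm_hausdorff.
  - exact: lin0 lphi.
  - by move=> a g h Zg Zh; rewrite /Z /= lphi Zg Zh scaler0 addr0.
have [g [Zg Pg]] := projection_theorem f cZ.
set v := f - g in Pg.
have pv : phi v = phi f by rewrite (linB lphi) Zg subr0.
have v0 : dot v v != 0.
  by rewrite dot_eq0; apply: contra nf => /eqP v0; rewrite -pv v0 (lin0 lphi).
exists ((phi v / dot v v)^* *: v) => h; rewrite dotZr conjCK.
have : dot (h - (phi h / phi v) *: v) v = 0.
  apply: dotC0; apply: Pg; rewrite /Z /= (linB lphi) (linZ lphi).
  by rewrite /GRing.scale/= divfK ?subrr// pv.
move/eqP; rewrite dotBl dotZl subr_eq0 => /eqP ->.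
by field; rewrite v0 pv nf.
Qed.

Definition adj H H' (T : H -> H') (g : H') : H :=
  get [set h | forall f, dot (T f) g = dot f h].

Lemma bop_dot H H' (T : H -> H') (g : H') : bounded_op T ->
  bounded_op (fun f => dot (T f) g : C^o).
Proof.
move=> bT; have [c c0 Tc] := bop_real bT; have [lT _] := bT.
split; first by move=> a f f'; rewrite lT dotDl dotZl.
exists (c * `|g|) => f; apply: le_trans (Cauchy_Schwarz _ _) _.
by rewrite mulrAC ler_wpM2r.
Qed.

Lemma adjE H H' (T : H -> H') f g : bounded_op T -> dot (T f) g = dot f (adj T g).
Proof.
move=> bT; move: f; apply: (getPex (P := [set h | forall f, dot (T f) g = dot f h])).
exact: (Riesz (bop_dot g bT)).
Qed.

Lemma adj_unique H H' (T : H -> H') g h : bounded_op T ->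
  (forall f, dot (T f) g = dot f h) -> adj T g = h.
Proof. by move=> bT E; apply: dot_inj => f; rewrite -adjE. Qed.

Lemma adj_bop H H' (T : H -> H') : bounded_op T -> bounded_op (adj T).
Proof.
move=> bT; have [c c0 Tc] := bop_real bT; split.
  move=> a f g; apply: adj_unique => // h.
  by rewrite !dotDr !dotZr -!adjE.
exists c => f; have [->|n0] := eqVneq (adj T f) 0.
  by rewrite normr0 mulr_ge0.
have n1 : 0 < `|adj T f| by rewrite normr_gt0.
rewrite -(ler_pM2r n1) -expr2 -dotE -adjE// mulrAC.
have := Cauchy_Schwarz (T (adj T f)) f.
have -> : `|dot (T (adj T f)) f| = dot (T (adj T f)) f.
  by rewrite adjE// dotE ger0_norm// exprn_ge0.
by move=> /le_trans; apply; rewrite ler_wpM2r.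
Qed.

Lemma adjEl H H' (T : H -> H') f g : bounded_op T -> dot (adj T g) f = dot g (T f).
Proof. by move=> bT; rewrite dotC -adjE// -dotC. Qed.

(** Together with a density argument this reduces identities between inner
    products to elementary tensors. *)
Lemma closed_subspace_dot2 H H1 H2 (S : H -> H1) (T : H -> H2) h k :
  bounded_op S -> bounded_op T -> closed_subspace [set f | dot (S f) h = dot (T f) k].
Proof.
move=> bS bT.
have -> : [set f | dot (S f) h = dot (T f) k] =
          [set f | dot f (adj S h - adj T k) = 0].
  apply/seteqP; split => f /=; rewrite dotBr -!adjE//.
    by move=> ->; rewrite subrr.
  by move/eqP; rewrite subr_eq0 => /eqP.
exact: closed_subspace_dotl.
Qed.

End Riesz.

(** * Polynomials in an operator and its adjoint *)

Lemma iter_linear (K : pzRingType) (V : lmodType K) (T : V -> V) k :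
  linear T -> linear (iter k T).
Proof. by move=> lT; elim: k => // k IH a f g /=; rewrite IH lT. Qed.

Section PolyCalculus.
Context {K : comNzRingType} {V : lmodType K}.
Variables (T S : V -> V).
Hypothesis (lT : linear T) (lS : linear S).
Implicit Types (r : {poly K}) (p : {poly {poly K}}) (f : V).

(** The value r(T) f of the polynomial r at the operator T. *)
Definition poly_op r f : V := \sum_(k < size r) r`_k *: iter k T f.

(** The value of p at the pair (T, S) with all powers of T on the left of the
    powers of S: the outer variable of p stands for S, the inner one for T. *)
Definition hereditary_op p f : V := \sum_(l < size p) poly_op p`_l (iter l S f).

Lemma papp_wide N r f : (size r <= N)%N ->
  poly_op r f = \sum_(k < N) r`_k *: iter k T f.
Proof.
move=> rN; rewrite /poly_op (big_ord_widen N (fun k => r`_k *: iter k T f))//.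
rewrite [RHS](bigID (fun k : 'I_N => (k < size r)%N))/= [X in _ + X]big1 ?addr0//.
by move=> k; rewrite -leqNgt => kr; rewrite nth_default// scale0r.
Qed.

Lemma papp_linear r : linear (poly_op r).
Proof.
move=> a f g; rewrite /poly_op scaler_sumr -big_split/=; apply: eq_bigr => k _.
by rewrite (iter_linear k lT) scalerDr !scalerA mulrC.
Qed.

Lemma papp_lincomb a r s f : poly_op (a *: r + s) f = a *: poly_op r f + poly_op s f.
Proof.
set N := maxn (size (a *: r + s)) (maxn (size r) (size s)).
rewrite !(@papp_wide N) ?leq_max ?leqnn ?orbT//.
rewrite scaler_sumr -big_split/=; apply: eq_bigr => k _.
by rewrite coefD coefZ scalerDl scalerA.
Qed.

Lemma pappMX r f : poly_op (r * 'X) f = poly_op r (T f).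
Proof.
rewrite (@papp_wide (size r).+1) ?size_polyMleq//.
  rewrite big_ord_recl coefMX/= scale0r add0r; apply: eq_bigr => k _.
  by rewrite coefMX /= -iterS iterSr.
by rewrite (leq_trans (size_polyMleq _ _))// size_polyX addn2.
Qed.

Lemma papp0 f : poly_op 0 f = 0.
Proof. by rewrite /poly_op size_poly0 big_ord0. Qed.

Lemma pappC c f : poly_op c%:P f = c *: f.
Proof. by rewrite (@papp_wide 1) ?size_polyC_leq1// big_ord1 coefC. Qed.

Lemma pappMXsubC r c f : poly_op (r * ('X - c%:P)) f = poly_op r (T f - c *: f).
Proof.
have -> : r * ('X - c%:P) = (- c) *: r + r * 'X.
  by rewrite mulrBr [_ * c%:P]mulrC mul_polyC scaleNr addrC.
rewrite papp_lincomb pappMX (linB (papp_linear r)) (linZ (papp_linear r)).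
by rewrite scaleNr addrC.
Qed.

Lemma papp_inv (W : set V) r f : W 0 -> (forall a f g, W f -> W g -> W (a *: f + g)) ->
  (forall f, W f -> W (T f)) -> W f -> W (poly_op r f).
Proof.
move=> W0 lW TW Wf.
apply: big_ind => // [g h Wg Wh|k _]; first by rewrite -[g]scale1r; apply: lW.
rewrite -[_ *: _]addr0; apply: lW => //.
by elim: (k : nat) => // m IH /=; apply: TW.
Qed.

Lemma her_wide N p f : (size p <= N)%N ->
  hereditary_op p f = \sum_(l < N) poly_op p`_l (iter l S f).
Proof.
move=> pN; rewrite /hereditary_op (big_ord_widen N (fun l => poly_op p`_l (iter l S f)))//.
rewrite [RHS](bigID (fun k : 'I_N => (k < size p)%N))/= [X in _ + X]big1 ?addr0//.
by move=> k; rewrite -leqNgt => kr; rewrite nth_default// papp0.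
Qed.

Lemma herC_sum N p f : (forall l k, (N <= l)%N || (N <= k)%N -> p`_l`_k = 0) ->
  hereditary_op p f = \sum_(l < N) \sum_(k < N) p`_l`_k *: iter k T (iter l S f).
Proof.
move=> pN; rewrite (@her_wide N).
  apply: eq_bigr => l _; apply: papp_wide.
  by apply/leq_sizeP => k Nk; rewrite pN// Nk orbT.
apply/leq_sizeP => l Nl; apply/polyP => k; rewrite coef0.
by rewrite pN// Nl.
Qed.

Lemma her_linear p : linear (hereditary_op p).
Proof.
move=> a f g; rewrite /hereditary_op scaler_sumr -big_split/=; apply: eq_bigr => l _.
by rewrite (iter_linear l lS) (papp_linear _).
Qed.

Lemma herMXsubC p c f : hereditary_op (p * ('X - c%:P%:P)) f = hereditary_op p (S f - c *: f).
Proof.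
have pN : (size (p * ('X - c%:P%:P))%R <= (size p).+1)%N.
  by rewrite (leq_trans (size_polyMleq _ _))// size_XsubC addn2.
rewrite (her_wide _ pN) (linB (her_linear p)) (linZ (her_linear p)).
have -> : hereditary_op p (S f) = \sum_(l < (size p).+1) poly_op (p * 'X)`_l (iter l S f).
  rewrite big_ord_recl coefMX papp0 add0r; apply: eq_bigr => l _.
  by rewrite coefMX/= -iterS iterSr.
rewrite (her_wide _ (leqnSn _)) scaler_sumr -sumrB; apply: eq_bigr => l _.
have -> : (p * ('X - c%:P%:P))`_l = (- c) *: p`_l + (p * 'X)`_l.
  by rewrite mulrBr coefB coefMC scaleNr addrC -mul_polyC mulrC.
by rewrite papp_lincomb// scaleNr addrC.
Qed.

Lemma her_eigen p c f : S f = c *: f -> hereditary_op p f = poly_op p.[c%:P] f.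
Proof.
move=> Sf; have Slf l : iter l S f = c ^+ l *: f.
  elim: l => [|l IH]; first by rewrite expr0 scale1r.
  by rewrite iterS IH (linZ lS) Sf scalerA exprSr.
rewrite horner_coef /hereditary_op.
elim: (size p) => [|N IH]; first by rewrite !big_ord0 papp0.
rewrite !big_ord_recr/= IH Slf (linZ (papp_linear _)) addrC.
by rewrite -rmorphXn/= [p`_N * _]mulrC mul_polyC [in RHS]addrC papp_lincomb.
Qed.

End PolyCalculus.

(** * A hereditary operator of rank one in one variable *)

Section OneVar.
Context {R : realType}.
Local Notation C := R[i].
Local Notation span := (smallest (@closed_subspace R _)).

Lemma bop_iter (V : normedModType C) (T : V -> V) k : bounded_op T -> bounded_op (iter k T).
Proof.
by move=> bT; elim: k => [|k IH]; [exact: bop_id|exact: (bop_comp bT IH)].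
Qed.

Lemma bop_papp (V : normedModType C) (T : V -> V) (r : {poly C}) :
  bounded_op T -> bounded_op (poly_op T r).
Proof.
move=> bT; apply: bop_sum => k; apply: bop_scale; exact: bop_iter.
Qed.

Lemma bop_her (V : normedModType C) (T S : V -> V) (p : {poly {poly C}}) :
  bounded_op T -> bounded_op S -> bounded_op (hereditary_op T S p).
Proof.
move=> bT bS; apply: bop_sum => k.
by apply: (bop_comp (bop_papp _ bT)); exact: bop_iter.
Qed.

(** Over an algebraically closed field r splits, and a factor T - mu that
    annihilates a nonzero vector exhibits an eigenvector. *)
Lemma eigenvector_in (V : lmodType C) (T : V -> V) (W : set V) (r : {poly C}) f :
  linear T -> W 0 -> (forall a f g, W f -> W g -> W (a *: f + g)) ->
  (forall f, W f -> W (T f)) ->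
  r != 0 -> W f -> f != 0 -> poly_op T r f = 0 ->
  exists mu g, [/\ W g, g != 0 & T g = mu *: g].
Proof.
move=> lT W0 lW TW; have [n] := ubnP (size r).
elim: n r f => // n IH r f rn r0 Wf f0 rf.
have [sr|sr] := leqP (size r) 1.
  move: rf r0; rewrite (size1_polyC sr) pappC => /eqP.
  rewrite scaler_eq0 (negPf f0) orbF => /eqP ->.
  by rewrite polyC0 eqxx.
have [mu /factor_theorem [q rq]] : exists mu, root r mu.
  by apply/closed_rootP; rewrite gtn_eqF.
have q0 : q != 0 by apply: contra_neq r0 => q0; rewrite rq q0 mul0r.
have [Tf|Tf] := eqVneq (T f - mu *: f) 0.
  by exists mu, f; split=> //; apply/eqP; rewrite -subr_eq0 Tf.
apply: (IH q (T f - mu *: f)) => //.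
- by rewrite -ltnS (leq_trans _ rn)// rq size_Mmonic ?monicXsubC// size_XsubC addn2.
- by rewrite addrC -scaleNr; apply: lW => //; exact: TW.
- by rewrite -pappMXsubC// -rq.
Qed.

Variable H : rkh_module R.
Local Notation M := (mulz H).
Local Notation Ms := (adj M).

Lemma bop_mulz : bounded_op M.
Proof. by apply: bop_of_cont; exact: mulz_bounded. Qed.
Hint Resolve bop_mulz : core.

Lemma bop_adj_mulz : bounded_op Ms. Proof. exact: adj_bop. Qed.
Hint Resolve bop_adj_mulz : core.

Lemma kernel_atE w f : `|w| < 1 -> ev H w f = dot f (kernel_at H w).
Proof.
move=> w1; move: f; apply: (getPex (P := [set k | forall f, ev H w f = dot f k])).
by apply: Riesz; apply: bop_of_cont; exact: ev_bounded.
Qed.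

Lemma adj_mulz_kernel w : `|w| < 1 -> Ms (kernel_at H w) = w^* *: kernel_at H w.
Proof.
move=> w1; apply: adj_unique => // f.
by rewrite -kernel_atE// mulzE// dotZr conjCK kernel_atE.
Qed.

Lemma span_kernel : span [set kernel_at H w | w in [set w | `|w| < 1]] = setT.
Proof.
apply: span_perp0 => f Pf; apply: (@ev_inj _ H) => z z1.
by rewrite kernel_atE// Pf//; exists z.
Qed.

Lemma ev_papp w r f : `|w| < 1 -> ev H w (poly_op M r f) = r.[w] * ev H w f.
Proof.
move=> w1; rewrite /poly_op linear_sum horner_coef mulr_suml; apply: eq_bigr => k _.
rewrite linearZ/= -mulrA; congr (_ * _).
elim: (k : nat) => [|m IH]; first by rewrite expr0 mul1r.
by rewrite iterS mulzE// IH exprS mulrA.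
Qed.

(** Such an f vanishes on the disc except at mu, and f is continuous. *)
Lemma mulz_no_eigenvector mu f : M f = mu *: f -> f = 0.
Proof.
move=> Mf; have ev0 z : `|z| < 1 -> z != mu -> ev H z f = 0.
  move=> z1 zmu; have := mulzE f z1; rewrite Mf linearZ/= => /eqP.
  rewrite -subr_eq0 -mulrBl mulf_eq0 subr_eq0 eq_sym (negPf zmu)/=.
  by move/eqP.
apply: (@ev_inj _ H) => z z1; have [zmu|] := eqVneq z mu; last exact: ev0.
have /derivable1_diffP/differentiable_continuous Fc := @ev_holo _ H f z z1.
apply/eqP/negPn/negP => nz0.
have near0 := cvgr_neq0 (FF := nbhs_filter _) _ Fc nz0.
have near1 : \forall w \near (z : C^o), `|w| < 1.
  apply/nbhs_ballP; exists (1 - `|z|); first by rewrite /= subr_gt0.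
  move=> w; rewrite -ball_normE /= => zw.
  have -> : w = z - (z - w) by rewrite opprB addrC subrK.
  by rewrite (le_lt_trans (ler_normB _ _))// addrC -ltrBrDr.
have : \forall w \near (z : C^o)^', False.
  near=> w.
  have w1 : `|w| < 1 by near: w; exact: nbhs_dnbhs.
  have /eqP : ev H w f != 0 by near: w; exact: nbhs_dnbhs.
  apply; apply: ev0 => //; rewrite -zmu.
  by near: w; exact: nbhs_dnbhs_neq.
exact: filter_not_empty.
Unshelve. all: by end_near. Qed.

Lemma papp_comm (V : lmodType C) (T : V -> V) r f : linear T ->
  poly_op T r (T f) = T (poly_op T r f).
Proof.
move=> lT; rewrite /poly_op (lin_sum lT); apply: eq_bigr => k _.
by rewrite (linZ lT) -iterSr.
Qed.

(** Stated through the orthogonal complement of the orbit, the form in which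
    cyclicity is obtained and used. *)
Definition cyclic_vec (g : H) := forall f, (forall k, dot f (iter k M g) = 0) -> f = 0.

Lemma kernel_at_neq0 w : `|w| < 1 -> kernel_at H w != 0.
Proof.
move=> w1; apply/eqP => k0; have := rkh_oneE H w1.
by rewrite kernel_atE// k0 dot0r => /eqP; rewrite eq_sym oner_eq0.
Qed.

Lemma adj_mulz_iter f g k : dot (iter k Ms f) g = dot f (iter k M g).
Proof. by elim: k g => // k IH g; rewrite iterS adjEl// IH -iterSr. Qed.

Lemma perp_orbit_inv (g f : H) : (forall k, dot f (iter k M g) = 0) ->
  forall k, dot (Ms f) (iter k M g) = 0.
Proof. by move=> fg k; rewrite adjEl// -iterS. Qed.

(** The line spanned by v and the orthogonal complement of the orbit of v are
    orthogonal quotient modules, and the line is nonzero. *)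
Lemma standard_eigenvector_cyclic (v : H) mu : standard H ->
  v != 0 -> Ms v = mu *: v -> cyclic_vec v.
Proof.
move=> stH v0 Mv f fv; apply/eqP; apply: contra_notT stH => f0.
pose G := [set iter k M v | k in [set: nat]].
exists (perp (perp [set v])), (perp G); split.
- split; first exact: closed_subspace_perp.
  split; first exact: closed_subspace_perp.
  have -> : perp (perp (perp [set v])) = perp [set v].
    by rewrite perp_perp//; exact: closed_subspace_perp.
  move=> _ g Pg _ ->.
  by rewrite adjE// Mv dotZr Pg ?mulr0.
- split; first exact: closed_subspace_perp.
  split; first exact: closed_subspace_perp.
  move=> _ g Pg h Ph; rewrite adjE//; apply: Pg => _ [k _ <-].
  by apply: perp_orbit_inv => m; apply: Ph; exists m.
- move=> E; have : perp (perp [set v]) v by apply: sub_perp_perp.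
  by rewrite E => /eqP; rewrite (negPf v0).
- move=> E; have : perp G f by move=> _ [k _ <-]; exact: fv.
  by rewrite E => /eqP; rewrite (negPf f0).
- move=> g h Pg Ph; apply: Pg => _ ->.
  by apply: Ph; exists 0%N.
Qed.

Lemma rank_one_bop (H1 H2 : hilbert R) (h : H1) (g : H2) :
  bounded_op (fun f : H1 => dot f h *: g).
Proof.
have [l [c dc]] := bop_dot h (@bop_id _ H1).
split; first by move=> a f f'; rewrite l scalerDl scalerA.
by exists (c * `|g|) => f; rewrite normrZ mulrAC ler_wpM2r.
Qed.

(** On the kernel function at w both sides evaluate at z to 1, because the
    kernel function is an eigenvector of the adjoint with eigenvalue the conjugate
    of w and p is the inverse of the kernel.  Kernel functions span the space. *)
Lemma her_kernel_one : polynomial_inverse_kernel H ->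
  exists p, forall f, hereditary_op M Ms p f = dot f (rkh_one H) *: rkh_one H.
Proof.
move=> [p pK]; exists (swapXY p) => f.
suff : span [set kernel_at H w | w in [set w | `|w| < 1]] `<=`
    [set f | hereditary_op M Ms (swapXY p) f = dot f (rkh_one H) *: rkh_one H].
  by rewrite span_kernel; apply.
apply: span_ind.
  exact: closed_subspace_eq (bop_her _ bop_mulz bop_adj_mulz)
    (rank_one_bop _ _).
move=> _ [w /= w1 <-].
rewrite (her_eigen (proj1 bop_mulz) (proj1 bop_adj_mulz) _ (adj_mulz_kernel w1)).
apply/eqP; rewrite -subr_eq0; apply/eqP; apply: (@ev_inj _ H) => z z1.
rewrite linearB linearZ/= rkh_oneE// ev_papp//.
rewrite [dot (kernel_at H w) _]dotC -kernel_atE// rkh_oneE// rmorph1 scale1r.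
have := horner2_swapXY p w^* z; rewrite /= => ->.
have [K0 <-] := pK _ _ z1 w1.
by rewrite /repro_kernel mulVf// subrr.
Qed.

(** If h is not cyclic, some f is orthogonal to its orbit.  Evaluating the
    hereditary operator at a point w with g(w) != 0 gives a polynomial r in the
    adjoint with r(M^* ) f orthogonal to the orbit of the kernel function at w,
    which is cyclic; so r(M^* ) f = 0 and M^* has an eigenvector orthogonal to
    the orbit of h.  The hereditary operator annihilates it, and M has no
    eigenvector, so p is divisible by the linear factor of its eigenvalue mu.
    The quotient has smaller degree and still has rank one, since M^* - mu has
    dense range. *)
Lemma hereditary_descent p (g h : H) : standard H -> g != 0 -> h != 0 ->
  (forall f, hereditary_op M Ms p f = dot f h *: g) ->
  exists p' h', [/\ h' != 0, cyclic_vec h' & forall f, hereditary_op M Ms p' f = dot f h' *: g].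
Proof.
move=> stH g0; have [n] := ubnP (size p).
have lM := proj1 bop_mulz; have lMs := proj1 bop_adj_mulz.
elim: n p h => // n IH p h pn h0 pgh.
have [cyc|ncyc] := pselect (cyclic_vec h); first by exists p, h.
have [f [fh f0]] : exists f : H, (forall k, dot f (iter k M h) = 0) /\ f != 0.
  apply: contrapT => nex; apply: ncyc => f fh; apply/eqP; apply: contrapT => /negP f0.
  by apply: nex; exists f.
have [w [w1 gw]] : exists w, `|w| < 1 /\ ev H w g != 0.
  apply: contrapT => nex; move/eqP: g0; apply; apply: (@ev_inj _ H) => w w1.
  by apply/eqP; apply: contrapT => /negP gw; apply: nex; exists w.
(* r(M^* ) f' and the hereditary operator at f' have the same value at w. *)
pose r : {poly C} := \poly_(l < size p) (p`_l).[w].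
have rE f' : ev H w (poly_op Ms r f') = dot f' h * ev H w g.
  transitivity (ev H w (hereditary_op M Ms p f')); last by rewrite pgh linearZ.
  rewrite (@papp_wide _ _ _ (size p)) ?size_poly// /hereditary_op !linear_sum.
  apply: eq_bigr => l _; rewrite linearZ/= ev_papp//.
  by rewrite coef_poly ltn_ord.
have kw0 := kernel_at_neq0 w1.
have rf : poly_op Ms r f = 0.
  apply: (standard_eigenvector_cyclic stH kw0 (adj_mulz_kernel w1)) => k.
  rewrite -adj_mulz_iter -kernel_atE//.
  have -> : iter k Ms (poly_op Ms r f) = poly_op Ms r (iter k Ms f).
    by elim: k => // k IHk; rewrite !iterS IHk papp_comm.
  by rewrite rE adj_mulz_iter fh mul0r.
have r0 : r != 0.
  apply/eqP => r0; have := rE h; rewrite r0 papp0 linear0 => /esym/eqP.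
  by rewrite mulf_eq0 dot_eq0 (negPf h0) (negPf gw).
have [mu [f' [f'h f'0 Mf']]] : exists mu (f' : H),
    [/\ forall k, dot f' (iter k M h) = 0, f' != 0 & Ms f' = mu *: f'].
  apply: (@eigenvector_in _ _ [set f | forall k, dot f (iter k M h) = 0] r f) => //=.
  - by move=> k; rewrite dot0l.
  - by move=> a f1 f2 E1 E2 k; rewrite dotDl dotZl E1 E2 mulr0 addr0.
  - by move=> f1 E1; exact: perp_orbit_inv.
have : root p mu%:P.
  apply/eqP; apply: contrapT => /eqP pmu.
  have := her_eigen lM lMs p Mf'; rewrite pgh (f'h 0%N) scale0r => /esym.
  move=> /(eigenvector_in (W := setT) lM I (fun _ _ _ _ _ => I) (fun _ _ => I) pmu I f'0).
  by move=> [nu [g' [_ g'0 /mulz_no_eigenvector]]]; apply/eqP.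
move=> /factor_theorem[p2 pp2].
have p20 : p2 != 0.
  apply: contra_neq h0 => p20; have := pgh h.
  rewrite pp2 p20 mul0r /hereditary_op size_poly0 big_ord0 => /esym/eqP.
  by rewrite scaler_eq0 (negPf g0) orbF dot_eq0 => /eqP.
have hp2 f1 : hereditary_op M Ms p2 (Ms f1 - mu *: f1) = dot f1 h *: g.
  by rewrite -herMXsubC// -pp2 pgh.
pose x := ((dot g g)^-1)^* *: g.
have gx : dot g x = 1 by rewrite /x dotZr conjCK mulVf// dot_eq0.
have bp2 : bounded_op (hereditary_op M Ms p2) by apply: bop_her.
pose h' := adj (hereditary_op M Ms p2) x.
have p2gh f1 : hereditary_op M Ms p2 f1 = dot f1 h' *: g.
  (* The range of M^* - mu is dense, because M has no eigenvector. *)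
  pose rg := [set Ms f - mu *: f | f in [set: H]].
  suff : span rg `<=` [set f | hereditary_op M Ms p2 f = dot f h' *: g].
    apply; rewrite span_perp0// => y Py; apply: (@mulz_no_eigenvector mu^*).
    apply/eqP; rewrite -subr_eq0 -dot_eq0; set z := _ - _.
    rewrite {1}/z dotBl dotZl adjE// -[mu^* * _]dotZr -dotBr Py//.
    by exists z.
  apply: span_ind; first exact: (closed_subspace_eq bp2 (rank_one_bop _ _)).
  move=> _ [f2 _ <-] /=; rewrite /h' -adjE// hp2.
  by rewrite dotZl gx mulr1.
have h'0 : h' != 0.
  apply: contra_neq h0 => h'0; have := hp2 h.
  rewrite p2gh h'0 dot0r scale0r => /esym/eqP.
  by rewrite scaler_eq0 (negPf g0) orbF dot_eq0 => /eqP.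
apply: (IH p2 h') => //.
by rewrite -ltnS (leq_trans _ pn)// pp2 size_Mmonic ?monicXsubC// size_XsubC addn2.
Qed.

Definition adj_poly (p : {poly {poly C}}) : {poly {poly C}} :=
  swapXY (map_poly (map_poly Num.conj) p).

Lemma coef_adj_poly p l k : (adj_poly p)`_l`_k = (p`_k`_l)^*.
Proof. by rewrite coef_swapXY coef_map/= coef_map. Qed.

Lemma dot_suml (H1 : hilbert R) I (r : seq I) (P : pred I) (F : I -> H1) g :
  dot (\sum_(i <- r | P i) F i) g = \sum_(i <- r | P i) dot (F i) g.
Proof. by apply: (big_morph (fun f => dot f g)) => [f h|]; rewrite ?dotDl ?dot0l. Qed.

Lemma dot_sumr (H1 : hilbert R) I (r : seq I) (P : pred I) (F : I -> H1) g :
  dot g (\sum_(i <- r | P i) F i) = \sum_(i <- r | P i) dot g (F i).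
Proof. by apply: (big_morph (fun f => dot g f)) => [f h|]; rewrite ?dotDr ?dot0r. Qed.

(** The adjoint of a hereditary polynomial is hereditary: exchange the two
    variables and conjugate the coefficients. *)
Lemma her_adj_poly p f g : dot (hereditary_op M Ms p f) g = dot f (hereditary_op M Ms (adj_poly p) g).
Proof.
pose N := maxn (size p) (sizeY p).
have pN l k : (N <= l)%N || (N <= k)%N -> p`_l`_k = 0.
  rewrite !geq_max => /orP[/andP[pl _]|/andP[_ pk]].
    by rewrite (nth_default _ pl) coef0.
  by rewrite nth_default// (leq_trans (max_size_coefXY _ _)).
rewrite !(@herC_sum _ _ _ _ N)//; last first.
  by move=> l k; rewrite orbC coef_adj_poly => /pN ->; rewrite rmorph0.
rewrite exchange_big/= dot_suml dot_sumr; apply: eq_bigr => k _.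
rewrite dot_suml dot_sumr; apply: eq_bigr => l _.
rewrite coef_adj_poly dotZl dotZr conjCK; congr (_ * _).
have adjadj : forall j y z, dot (iter j M y) z = dot y (iter j Ms z).
  by move=> j y z; rewrite dotC -adj_mulz_iter -dotC.
by rewrite adjadj -adj_mulz_iter.
Qed.

(** One descent makes the right vector cyclic; passing to adjoints turns it
    into the left vector, and a second descent treats the other one. *)
Lemma hereditary_rank_one : standard H -> polynomial_inverse_kernel H ->
  exists p (g h : H), [/\ cyclic_vec g, cyclic_vec h &
    forall f, hereditary_op M Ms p f = dot f h *: g].
Proof.
move=> stH /her_kernel_one[p0 E0].
have one0 : rkh_one H != 0.
  apply/eqP => one0; have /(rkh_oneE H) : `|0 : C| < 1 by rewrite normr0.
  by rewrite one0 linear0 => /esym/eqP; rewrite oner_eq0.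
have [p1 [h [h0 hcyc E1]]] := hereditary_descent stH one0 one0 E0.
have E1' f : hereditary_op M Ms (adj_poly p1) f = dot f (rkh_one H) *: h.
  apply: dot_inj => y; rewrite -her_adj_poly E1 dotZl dotZr.
  by rewrite -dotC mulrC.
(* E1' is the adjoint of E1, with h now on the left. *)
have [p2 [g [g0 gcyc E2]]] := hereditary_descent stH h0 one0 E1'.
by exists p2, h, g.
Qed.

End OneVar.

(** * Operators on one factor of a tensor product *)

Section Tensor.
Context {R : realType} {n : nat} {Hs : 'I_n -> rkh_module R}.
Variable H : tensor_product Hs.
Local Notation C := R[i].
Local Notation span := (smallest (@closed_subspace R _)).
Local Notation ten := (tensor H).
Local Notation vecs := (forall i, Hs i).
Implicit Types (i j : 'I_n) (f g : vecs) (F G : H).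

Lemma dfwithC f i j (x : Hs i) (y : Hs j) : i != j ->
  dfwith (dfwith f i x) j y = dfwith (dfwith f j y) i x.
Proof.
move=> ij; apply: functional_extensionality_dep => k.
have [<-|jk] := eqVneq j k.
  by rewrite dfwithin dfwithout ?dfwithin.
rewrite dfwithout//; have [<-|ik] := eqVneq i k; first by rewrite !dfwithin.
by rewrite !dfwithout.
Qed.

Lemma dfwithK f i (x y : Hs i) : dfwith (dfwith f i x) i y = dfwith f i y.
Proof.
apply: functional_extensionality_dep => k.
by have [<-|ik] := eqVneq i k; rewrite ?dfwithin// !dfwithout.
Qed.

Lemma dfwith_id f i : dfwith f i (f i) = f.
Proof.
apply: functional_extensionality_dep => k.
by have [<-|ik] := eqVneq i k; rewrite ?dfwithin// !dfwithout.
Qed.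

Lemma dot_dfwith f g i (x y : Hs i) :
  dot (ten (dfwith f i x)) (ten (dfwith g i y)) =
  dot x y * \prod_(j < n | j != i) dot (f j) (g j).
Proof.
rewrite tensor_dot (bigD1 i)//= !dfwithin; congr (_ * _).
by apply: eq_bigr => j ji; rewrite !dfwithout// eq_sym.
Qed.

Lemma dot_dfwithl f g i (x : Hs i) :
  dot (ten (dfwith f i x)) (ten g) =
  dot x (g i) * \prod_(j < n | j != i) dot (f j) (g j).
Proof. by rewrite -dot_dfwith dfwith_id. Qed.

Lemma dot_dfwithr f g i (x : Hs i) :
  dot (ten f) (ten (dfwith g i x)) =
  dot (f i) x * \prod_(j < n | j != i) dot (f j) (g j).
Proof. by rewrite -dot_dfwith dfwith_id. Qed.

Lemma bop_ten f i : bounded_op (fun x : Hs i => ten (dfwith f i x)).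
Proof.
split; first by move=> a x y; rewrite tensor_linear.
exists (\prod_(j < n | j != i) `|f j|) => x.
rewrite -(@ler_pXn2r _ 2)// ?nnegrE ?mulr_ge0 ?prodr_ge0//.
rewrite -dotE dot_dfwith dotE exprMn -prodrXl mulrC.
by rewrite (eq_bigr (fun j => `|f j| ^+ 2))// => j _; rewrite dotE.
Qed.

Lemma ten_ind (S : set H) : closed_subspace S -> (forall f, S (ten f)) -> forall F, S F.
Proof.
move=> cS Sf F; have : [set: H] F by [].
by rewrite -(tensor_dense H); move: F; apply: span_ind => // _ [f _ <-].
Qed.

Lemma ten_eq (V : hilbert R) (S T : H -> V) : bounded_op S -> bounded_op T ->
  (forall f, S (ten f) = T (ten f)) -> forall F, S F = T F.
Proof. by move=> bS bT; apply: ten_ind; exact: closed_subspace_eq. Qed.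

Lemma dot_ten_inj F G : (forall f, dot F (ten f) = dot G (ten f)) -> F = G.
Proof.
move=> FG; apply/eqP; rewrite -subr_eq0 -dot_eq0; apply/eqP.
apply: (@ten_ind [set h | dot (F - G) h = 0]); first exact: closed_subspace_dotr.
by move=> f /=; rewrite dotBl FG subrr.
Qed.

Local Notation M i := (tensor_mul H i).
Local Notation Ms i := (adj (tensor_mul H i)).

Lemma bop_M i : bounded_op (M i).
Proof. by apply: bop_of_cont; exact: tensor_mul_bounded. Qed.
Hint Resolve bop_M : core.
Lemma bop_Ms i : bounded_op (Ms i). Proof. exact: adj_bop. Qed.
Hint Resolve bop_Ms : core.

(** A is the operator I (x) .. (x) a (x) .. (x) I with a in the i-th place. *)
Definition acts_at i (A : H -> H) (a : Hs i -> Hs i) :=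
  forall f, A (ten f) = ten (dfwith f i (a (f i))).

Lemma acts_M i : acts_at (M i) (mulz (Hs i)).
Proof. by move=> f; rewrite tensor_mulE. Qed.

Lemma acts_Ms i : acts_at (Ms i) (adj (mulz (Hs i))).
Proof.
move=> f; apply: adj_unique => // F; move: F; apply: ten_ind.
  exact: (closed_subspace_dot2 _ _ (bop_M i) (bop_id _)).
move=> g /=; rewrite tensor_mulE dot_dfwithl dot_dfwithr adjE//.
exact: bop_mulz.
Qed.

Lemma acts_iter i A a k : @acts_at i A a -> acts_at (iter k A) (iter k a).
Proof.
move=> Aa; elim: k => [|k IH] f /=; first by rewrite dfwith_id.
by rewrite IH Aa dfwithK dfwithin.
Qed.

Lemma acts_comp i A a B b : @acts_at i A a -> @acts_at i B b ->
  acts_at (A \o B) (a \o b).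
Proof. by move=> Aa Bb f /=; rewrite Bb Aa dfwithK dfwithin. Qed.

Lemma acts_sum i N (c : 'I_N -> C) (A : 'I_N -> H -> H) (a : 'I_N -> Hs i -> Hs i) :
  (forall k, acts_at (A k) (a k)) ->
  acts_at (fun F => \sum_(k < N) c k *: A k F) (fun x => \sum_(k < N) c k *: a k x).
Proof.
move=> Aa f; have [l _] := bop_ten f i.
rewrite (lin_sum l); apply: eq_bigr => k _.
by rewrite (linZ l) Aa.
Qed.

Lemma acts_papp i A a r : @acts_at i A a -> acts_at (poly_op A r) (poly_op a r).
Proof. by move=> Aa; apply: acts_sum => k; exact: acts_iter. Qed.

Lemma acts_her i A a B b p : @acts_at i A a -> @acts_at i B b ->
  acts_at (hereditary_op A B p) (hereditary_op a b p).
Proof.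
move=> Aa Bb f; have [l _] := bop_ten f i.
rewrite (lin_sum l); apply: eq_bigr => k _.
exact: (acts_comp (acts_papp _ Aa) (acts_iter k Bb)).
Qed.

Lemma acts_commute i j A a B b F : i != j -> bounded_op A -> bounded_op B ->
  @acts_at i A a -> @acts_at j B b -> A (B F) = B (A F).
Proof.
move=> ij bA bB Aa Bb; move: F.
apply: (ten_eq (bop_comp bA bB) (bop_comp bB bA)) => f /=.
have ji : j != i by rewrite eq_sym.
by rewrite Aa !Bb !Aa (dfwithout _ _ ji) (dfwithout _ _ ij) dfwithC.
Qed.

(** G is the image of F under the operator x |-> <x, v> u on the i-th factor,
    characterised by its inner products with elementary tensors. *)
Definition rank1_spec i (u v : Hs i) F G :=
  forall f, dot G (ten f) = dot u (f i) * dot F (ten (dfwith f i v)).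

(** For u = v the operator is |u|^2 times the projection onto the closed span
    of the elementary tensors with i-th entry u. *)
Lemma rank1_diag i (u : Hs i) F :
  exists G, rank1_spec u u F G /\ `|G| <= `|u| ^+ 2 * `|F|.
Proof.
have [->|u0] := eqVneq u 0.
  exists 0; split => [f|]; first by rewrite !dot0l mul0r.
  by rewrite [leLHS]normr0 mulr_ge0 ?exprn_ge0.
pose W := span [set ten (dfwith f i u) | f in [set: vecs]].
have cW : closed_subspace W by exact: closed_subspace_span.
have duu : dot u u != 0 by rewrite dot_eq0.
exists (dot u u *: orth_proj W F); split; last first.
  by rewrite normrZ dotE ger0_norm ?exprn_ge0// ler_wpM2l ?exprn_ge0// orth_proj_norm.
move=> f; rewrite dotZl orth_proj_sa//.
have [l _] := bop_ten f i.
have -> : orth_proj W (ten f) = (dot (f i) u / dot u u) *: ten (dfwith f i u).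
  apply: orth_proj_unique => //.
    by apply: (closed_subspaceZ _ cW); apply: sub_span; exists f.
  rewrite -[in ten f](dfwith_id f i) -(linZ l) -(linB l) /W perp_span.
  move=> _ [g _ <-]; rewrite dot_dfwith dotBl dotZl divfK// subrr mul0r//.
rewrite dotZr mulrA; congr (_ * _).
rewrite rmorphM fmorphV/= -!dotC mulrCA divff ?mulr1//.
Qed.

(** By polarisation from the case u = v, since the right-hand side of
    [rank1_spec] is linear in u and conjugate-linear in v. *)
Lemma rank1_exists i (u v : Hs i) F :
  exists G, rank1_spec u v F G /\ `|G| <= (`|u| + `|v|) ^+ 2 * `|F|.
Proof.
have ex c : exists G, rank1_spec (u + c *: v) (u + c *: v) F G /\
    `|G| <= `|u + c *: v| ^+ 2 * `|F| by exact: rank1_diag.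
have [G1 [E1 L1]] := ex 1; have [G2 [E2 L2]] := ex (-1).
have [G3 [E3 L3]] := ex 'i; have [G4 [E4 L4]] := ex (- 'i).
exists (4^-1 *: (G1 - G2 + 'i *: (G3 - G4))); split.
  move=> f; rewrite dotZl dotDl dotZl !dotBl E1 E2 E3 E4.
  have TE c : dot F (ten (dfwith f i (u + c *: v))) =
      dot F (ten (dfwith f i u)) + c^* * dot F (ten (dfwith f i v)).
    have [l _] := bop_ten f i.
    by rewrite addrC l dotDr dotZr addrC.
  have UE c : dot (u + c *: v) (f i) = dot u (f i) + c * dot v (f i).
    by rewrite dotDl dotZl.
  rewrite !TE !UE !rmorphN !rmorph1 /= !conjCi.
  set a := dot u _; set b := dot v _; set c := dot F _; set d := dot F _.
  have ii : ('i : C) ^+ 2 = -1 by rewrite sqrCi.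
  by field: ii.
have bnd c G : `|c| = 1 -> `|G| <= `|u + c *: v| ^+ 2 * `|F| ->
    `|G| <= (`|u| + `|v|) ^+ 2 * `|F|.
  move=> c1 /le_trans; apply; rewrite ler_wpM2r// ler_pXn2r// ?nnegrE ?addr_ge0//.
  by rewrite (le_trans (ler_normD _ _))// normrZ c1 mul1r.
have B1 := bnd _ _ (normr1 _) L1.
have B2 := bnd (-1) _ (normrN1 _) L2.
have B3 := bnd _ _ (normCi _) L3.
have B4 : `|G4| <= (`|u| + `|v|) ^+ 2 * `|F| by apply: bnd L4; rewrite normrN normCi.
rewrite normrZ normfV [`|4|]ger0_norm// ler_pdivrMl//.
have -> : 4 * ((`|u| + `|v|) ^+ 2 * `|F|) =
  ((`|u| + `|v|) ^+ 2 * `|F| + (`|u| + `|v|) ^+ 2 * `|F|) +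
  ((`|u| + `|v|) ^+ 2 * `|F| + (`|u| + `|v|) ^+ 2 * `|F|) by ring.
rewrite (le_trans (ler_normD _ _))// lerD// ?normrZ ?normCi ?mul1r.
  by rewrite (le_trans (ler_normB _ _))// lerD.
by rewrite (le_trans (ler_normB _ _))// lerD.
Qed.

Definition rank1 i (u v : Hs i) F : H := get (rank1_spec u v F).

Lemma rank1E i (u v : Hs i) F f :
  dot (rank1 u v F) (ten f) = dot u (f i) * dot F (ten (dfwith f i v)).
Proof.
have [G [GE _]] := rank1_exists u v F.
by move: f; apply: (getPex (ex_intro (rank1_spec u v F) G GE)).
Qed.

Lemma rank1_unique i (u v : Hs i) F G : rank1_spec u v F G -> rank1 u v F = G.
Proof. by move=> GE; apply: dot_ten_inj => f; rewrite rank1E GE. Qed.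

Lemma rank1_bound i (u v : Hs i) F : `|rank1 u v F| <= (`|u| + `|v|) ^+ 2 * `|F|.
Proof. by have [G [/rank1_unique ->]] := rank1_exists u v F. Qed.

Lemma bop_rank1 i (u v : Hs i) : bounded_op (rank1 u v).
Proof.
split; last by eexists; exact: rank1_bound.
move=> a F G; apply: rank1_unique => f.
by rewrite !dotDl !dotZl !rank1E mulrDr mulrCA.
Qed.

(** [rank1_bound] is not homogeneous in u; it is applied to u rescaled to norm
    one. *)
Lemma bop_rank1l i (v : Hs i) F : bounded_op (fun u : Hs i => rank1 u v F).
Proof.
have l : linear (fun u : Hs i => rank1 u v F).
  move=> a u w; apply: rank1_unique => f.
  by rewrite !dotDl !dotZl !rank1E mulrDl mulrA.
split => //; exists ((1 + `|v|) ^+ 2 * `|F|) => u.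
have [->|u0] := eqVneq u 0; first by rewrite (lin0 l) !normr0 mulr0.
have nu : `|u| != 0 by rewrite normr_eq0.
have {1}-> : u = `|u| *: (`|u|^-1 *: u) by rewrite scalerA divff// scale1r.
rewrite (linZ l) normrZ normr_id mulrC ler_wpM2r//.
apply: le_trans (rank1_bound _ _ _) _.
by rewrite normrZ normfV normr_id mulVf.
Qed.

Lemma rank1_ten i (u v : Hs i) f :
  rank1 u v (ten f) = dot (f i) v *: ten (dfwith f i u).
Proof.
apply: rank1_unique => g.
by rewrite dotZl dot_dfwithl dot_dfwithr mulrCA.
Qed.

Lemma rank1_adj i (u v : Hs i) F G : dot (rank1 u v F) G = dot F (rank1 v u G).
Proof.
suff E : dot G (rank1 u v F) = dot (rank1 v u G) F by rewrite dotC E -dotC.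
move: G; apply: ten_ind.
  exact: (closed_subspace_dot2 _ _ (bop_id _) (bop_rank1 _ _)).
by move=> f /=; rewrite rank1_ten dotC rank1E rmorphM /= -!dotC dotZl.
Qed.

Lemma rank1_eq i A (u v : Hs i) F : bounded_op A ->
  @acts_at i A (fun x => dot x v *: u) -> A F = rank1 u v F.
Proof.
move=> bA Aa; move: F; apply: ten_eq => // [|f]; first exact: bop_rank1.
have [l _] := bop_ten f i.
by rewrite Aa rank1_ten (linZ l).
Qed.

(** Since g is cyclic, D contains the images for all u; since h is cyclic and
    the adjoint exchanges u and v, it also contains them for all v. *)
Lemma rank1_closure i (g h : Hs i) F (D : set H) : closed_subspace D ->
  cyclic_vec g -> cyclic_vec h ->
  (forall k l, D (@rank1 i (iter k (mulz (Hs i)) g) (iter l (mulz (Hs i)) h) F)) ->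
  forall u v, D (@rank1 i u v F).
Proof.
move=> cD gcyc hcyc Dkl.
have spanT (g' : Hs i) : cyclic_vec g' ->
    span [set iter k (mulz (Hs i)) g' | k in [set: nat]] = setT.
  by move=> g'c; apply: span_perp0 => f Pf; apply: g'c => k; apply: Pf; exists k.
have D1 l u : D (@rank1 i u (iter l (mulz (Hs i)) h) F).
  have : [set: Hs i] u by [].
  rewrite -(spanT g gcyc); move: u; apply: span_ind.
    exact: (closed_subspace_preimage (bop_rank1l _ F)).
  by move=> _ [k _ <-] /=.
move=> u v; rewrite -(perp_perp cD) => N PN; rewrite rank1_adj.
have : [set: Hs i] v by [].
rewrite -(spanT h hcyc); move: v; apply: span_ind.
  exact: (closed_subspace_preimage (bop_rank1l u N) (closed_subspace_dotr F)).
move=> _ [l _ <-] /=; rewrite -rank1_adj; apply: dotC0.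
by apply: PN; exact: D1.
Qed.

End Tensor.

(** * Doubly commuting quotient modules are tensor products *)

Lemma quotient_adj (R : realType) (K : hilbert R) (I : Type) (T : I -> K -> K)
    (Q : set K) i F :
  bounded_op (T i) -> quotient_module T Q -> Q F -> Q (adj (T i) F).
Proof.
move=> bT [cQ [_ PT]] QF; rewrite -(perp_perp cQ) => G PG.
by rewrite adjEl//; apply: dotC0; apply: PT.
Qed.

Section Main.
Context {R : realType} {n : nat} {Hs : 'I_n -> rkh_module R}.
Variable H : tensor_product Hs.
Local Notation C := R[i].
Local Notation span := (smallest (@closed_subspace R _)).
Local Notation ten := (tensor H).
Local Notation vecs := (forall i, Hs i).
Implicit Types (i j : 'I_n) (f g : vecs) (F G : H) (A B : pred 'I_n).
Local Notation M i := (tensor_mul H i).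
Local Notation Ms i := (adj (tensor_mul H i)).
Local Notation bop_M := (bop_M H).
Local Notation bop_Ms := (bop_Ms H).

Variable Q : set H.
Hypothesis hQ : quotient_module (tensor_mul H) Q.
Local Notation P := (orth_proj Q).

Lemma Q_closed : closed_subspace Q. Proof. by case: hQ. Qed.
Hint Resolve Q_closed : core.

Lemma Q_P F : Q (P F). Proof. by case: (orth_projP F Q_closed). Qed.

Lemma Q_Ms i F : Q F -> Q (Ms i F).
Proof. exact: (@quotient_adj _ _ _ (fun k => M k) Q i F (bop_M i) hQ). Qed.

(** The orthogonal complement of Q is invariant under M_i. *)
Lemma P_M i F : P (M i F) = P (M i (P F)).
Proof.
have lP := (orth_proj_bop Q_closed).1; have lM := (bop_M i).1.
apply/eqP; rewrite -subr_eq0 -(linB lP) -(linB lM); apply/eqP.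
have [_ [_ PM]] := hQ; apply: orth_proj_unique => //; first by case: Q_closed.
by rewrite subr0; apply: PM; case: (orth_projP F Q_closed).
Qed.

Lemma adjoint_on_compression i F : Q F ->
  adjoint_on Q (compression Q (M i)) F = Ms i F.
Proof.
move=> QF; rewrite /adjoint_on.
have S0 : [set h | Q h /\ forall G, Q G -> dot (compression Q (M i) G) F = dot G h] (Ms i F).
  split; first exact: Q_Ms.
  by move=> f Qf; rewrite orth_proj_dotl// adjE//; exact: bop_M.
have [Qh hE] := getI S0.
apply/eqP; rewrite -subr_eq0 -dot_eq0; apply/eqP.
set G := get _; have QG : Q (G - Ms i F).
  by apply: (closed_subspaceB Q_closed Qh); exact: Q_Ms.
rewrite [LHS]dotBr -(hE _ QG) -adjE; last exact: bop_M.
by rewrite orth_proj_dotl// subrr.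
Qed.

(** On Q the adjoint of the compression of M_j is the restriction of M_j^*.
    The condition for i > j is the adjoint of the one for i < j. *)
Lemma doubly_commutingP : doubly_commuting (tensor_mul H) Q <->
  forall i j, i != j -> forall F, Q F -> P (M i (Ms j F)) = Ms j (P (M i F)).
Proof.
split=> [dc|dc]; last first.
  move=> i j ij F QF; rewrite !adjoint_on_compression//; last exact: Q_P.
  by rewrite /compression dc// -val_eqE/= ltn_eqF.
have lt i j F : (i < j)%N -> Q F -> P (M i (Ms j F)) = Ms j (P (M i F)).
  move=> ij QF; have := dc i j ij F QF.
  by rewrite !adjoint_on_compression//; exact: Q_P.
move=> i j; rewrite -val_eqE/= neq_ltn => /orP[ij|ji] F QF; first exact: lt.
have bM k := bop_M k.
apply/eqP; rewrite -subr_eq0 -dot_eq0; apply/eqP.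
set G := _ - _; have QG : Q G.
  by apply: (closed_subspaceB Q_closed); [exact: Q_P|exact/Q_Ms/Q_P].
rewrite {1}/G dotBl orth_proj_dotl//.
have -> : dot (M i (Ms j F)) G = dot (M i F) (P (M j G)).
  rewrite adjE// adjEl// -[F in LHS](orth_proj_id Q_closed QF) orth_proj_sa//.
  by rewrite lt// -adjE.
by rewrite adjEl// orth_proj_sa// subrr.
Qed.

(** The closed span of the products of the M_j, j in A, applied to Q. *)
Definition reach (A : pred 'I_n) : set H :=
  smallest (fun S => closed_subspace S /\ forall j F, A j -> S F -> S (M j F)) Q.

Lemma reach_ind A (S : set H) : closed_subspace S -> Q `<=` S ->
  (forall j F, A j -> S F -> S (M j F)) -> reach A `<=` S.
Proof. by move=> cS QS MS; apply: smallest_sub. Qed.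

Lemma sub_reach A : Q `<=` reach A.
Proof. exact: sub_smallest. Qed.

Lemma closed_reach A : closed_subspace (reach A).
Proof. by apply: closed_subspace_bigI => S [[cS _] _]. Qed.

Lemma reach_M A j F : A j -> reach A F -> reach A (M j F).
Proof. by move=> Aj DF S hS; have [[_ MS] _] := hS; apply: MS => //; exact: (DF S hS). Qed.

Lemma reachS (A B : pred 'I_n) : (forall j, A j -> B j) -> reach A `<=` reach B.
Proof.
move=> AB; apply: reach_ind; [exact: closed_reach|exact: sub_reach|].
by move=> j F /AB; exact: reach_M.
Qed.

Lemma MMs i j F : i != j -> M i (Ms j F) = Ms j (M i F).
Proof.
move=> ij; apply: (acts_commute _ ij (bop_M i) (bop_Ms j)) => f; first exact: acts_M.
exact: acts_Ms.
Qed.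

(** M_j^* preserves Q and commutes with the M_i for i != j. *)
Lemma reach_Ms A j F : ~~ A j -> reach A F -> reach A (Ms j F).
Proof.
move=> Aj; move: F; apply: reach_ind.
- exact: (closed_subspace_preimage (bop_Ms j) (closed_reach A)).
- by move=> F QF /=; apply: sub_reach; exact: Q_Ms.
- move=> i F Ai /= DF; rewrite -MMs; first exact: reach_M.
  by apply: contraNneq Aj => <-.
Qed.

Lemma reach_iter_Ms A j k F : ~~ A j -> reach A F -> reach A (iter k (Ms j) F).
Proof. by move=> Aj DF; elim: k => //= k IH; exact: reach_Ms. Qed.

Lemma reach_iter_M A j k F : A j -> reach A F -> reach A (iter k (M j) F).
Proof. by move=> Aj DF; elim: k => //= k IH; exact: reach_M. Qed.

Hypothesis hH : analytic_module H.

(** For u in the orbit of g and v in the orbit of h the operator is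
    M_j^k p(M_j, M_j^* ) M_j^*^l, whose adjoint part preserves [reach A]; then
    [rank1_closure] applies. *)
Lemma reach_rank1 (A B : pred 'I_n) j (u v : Hs j) F :
  (forall k, A k -> B k) -> ~~ A j -> B j -> reach A F -> reach B (rank1 u v F).
Proof.
move=> AB Aj Bj DF; have [st pk] := hH j.
have [p [g [h [gcyc hcyc pE]]]] := hereditary_rank_one st pk.
apply: (rank1_closure (closed_reach B) gcyc hcyc) => k l.
pose T := iter k (M j) \o (hereditary_op (M j) (Ms j) p \o iter l (Ms j)).
have bT : bounded_op T.
  apply: bop_comp; first exact/bop_iter/bop_M.
  apply: bop_comp; last exact/bop_iter/bop_Ms.
  by apply: bop_her; [exact: bop_M|exact: bop_Ms].
rewrite -(@rank1_eq _ _ _ _ j T)//.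
  rewrite /T /=; apply: reach_iter_M => //.
  apply: (closed_subspace_sum _ (closed_reach B)) => m _.
  have [_ B0 lB] := closed_reach B.
  apply: (papp_inv (W := reach B)) => // [G|]; first exact: reach_M.
  by apply: (reachS AB); do 2![apply: reach_iter_Ms => //].
have aT := acts_comp (acts_iter k (@acts_M _ _ _ H j))
  (acts_comp (acts_her p (@acts_M _ _ _ H j) (@acts_Ms _ _ _ H j))
    (acts_iter l (@acts_Ms _ _ _ H j))).
move=> f; rewrite /T aT /=.
congr (ten (dfwith _ _ _)); rewrite pE adj_mulz_iter.
by rewrite (linZ (iter_linear _ (proj1 (bop_mulz _)))).
Qed.

Hypothesis dc : doubly_commuting (tensor_mul H) Q.

(** Double commutation lets M_j^* pass through P M_i. *)
Lemma P_Ms_reach i j F : i != j -> reach (pred1 i) F -> P (Ms j F) = Ms j (P F).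
Proof.
move=> ij; have bP := orth_proj_bop Q_closed.
move: F; apply: reach_ind.
- exact: (closed_subspace_eq (bop_comp bP (bop_Ms j)) (bop_comp (bop_Ms j) bP)).
- by move=> F QF /=; rewrite !orth_proj_id//; exact: Q_Ms.
- move=> k F /eqP -> /= E; rewrite -MMs// P_M E.
  by rewrite (iffLR doubly_commutingP dc)// -?P_M//; exact: Q_P.
Qed.

(** This says that the components of F and G orthogonal to Q are orthogonal
    to each other.  Each M_j with j != i is moved to the left argument as M_j^*,
    which commutes with P on [reach {i}]. *)
Lemma reach_orth i F G : reach (pred1 i) F -> reach (predC1 i) G ->
  dot (P F) G = dot F G.
Proof.
move=> DF DG; move: G DG F DF.
have -> : (forall G, reach (predC1 i) G ->
    forall F, reach (pred1 i) F -> dot (P F) G = dot F G) =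
  (reach (predC1 i) `<=` \bigcap_(F in reach (pred1 i)) [set G | dot G (P F - F) = 0]).
  apply/propext; split => E G DG F DF /=.
    by rewrite dotBr dotC E// -dotC subrr.
  have /= := E G DG F DF; rewrite dotBr => /eqP; rewrite subr_eq0 => /eqP E'.
  by rewrite dotC E' -dotC.
apply: reach_ind.
- by apply: closed_subspace_bigI => F _; exact: closed_subspace_dotl.
- move=> G QG F DF /=; rewrite dotBr dotC orth_proj_dotl// -dotC subrr//.
- move=> j G ji DG F DF /=; rewrite adjE; last exact: bop_M.
  rewrite (linB (bop_Ms j).1) -(@P_Ms_reach i)//; last by rewrite eq_sym.
  apply: DG; apply: reach_Ms => //=; by rewrite eq_sym.
Qed.

Lemma reach_cap i F : reach (pred1 i) F -> reach (predC1 i) F -> Q F.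
Proof.
move=> D1 D2; have := reach_orth D1 D2.
move/eqP; rewrite eq_sym -subr_eq0 -dotBl => /eqP E.
have : dot (F - P F) (F - P F) = 0.
  rewrite dotBr E [X in _ - X](_ : _ = 0) ?subrr//.
  by have [_] := orth_projP F Q_closed; apply; exact: Q_P.
by move/eqP; rewrite dot_eq0 subr_eq0 => /eqP ->; exact: Q_P.
Qed.

Definition rank1s (l : seq 'I_n) (x y : vecs) F : H :=
  foldr (fun j G => rank1 (x j) (y j) G) F l.

Definition override (l : seq 'I_n) (y f : vecs) : vecs :=
  fun k => if k \in l then y k else f k.

Lemma override_cons j l y f : j \notin l -> override l y (dfwith f j (y j)) = override (j :: l) y f.
Proof.
move=> jl; apply: functional_extensionality_dep => k; rewrite /override inE.
case: ifPn => [_|kl]; first by rewrite orbT.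
rewrite orbF; have [->|kj] := eqVneq k j; first by rewrite dfwithin.
by rewrite dfwithout// eq_sym.
Qed.

Lemma rank1sE l x y F f : uniq l ->
  dot (rank1s l x y F) (ten f) =
  (\prod_(j <- l) dot (x j) (f j)) * dot F (ten (override l y f)).
Proof.
elim: l f => [f _|j l IH f /= /andP[jl ul]]; first by rewrite big_nil mul1r.
rewrite rank1E IH// big_cons mulrA override_cons//; congr (_ * _ * _).
apply: eq_big_seq => k kl; rewrite dfwithout//.
by apply: contraNneq jl => ->.
Qed.

Lemma reach_rank1s l x y F : uniq l -> Q F -> reach (mem l) (rank1s l x y F).
Proof.
elim: l => [_ QF|j l IH /= /andP[jl ul] QF]; first exact: sub_reach.
apply: reach_rank1 (IH ul QF) => //=; last exact: mem_head.
by move=> k kl; rewrite inE kl orbT.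
Qed.

(** The orthogonal complement of the slices of Q in the i-th factor. *)
Definition coslice i : set (Hs i) :=
  [set x | forall y : vecs, perp Q (ten (dfwith y i x))].
Arguments coslice : clear implicits.

Lemma coslice_submodule i : submodule (fun _ : unit => mulz (Hs i)) (coslice i).
Proof.
split.
  have -> : coslice i = \bigcap_(y in [set: vecs]) [set x | perp Q (ten (dfwith y i x))].
    by apply/seteqP; split => x Sx y; [move=> _; exact: Sx|exact: (Sx y I)].
  apply: closed_subspace_bigI => y _.
  exact: (closed_subspace_preimage (bop_ten _ _ _) (closed_subspace_perp _)).
move=> _ x Sx y; have [_ [_ PM]] := hQ.
have := PM i _ (Sx y); rewrite tensor_mulE dfwithK dfwithin; exact.
Qed.

Definition slice i : set (Hs i) := perp (coslice i).
Arguments slice : clear implicits.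

Lemma slice_quotient i : quotient_module1 (slice i).
Proof.
split; first exact: closed_subspace_perp.
rewrite /slice perp_perp; first exact: coslice_submodule.
by case: (coslice_submodule i).
Qed.

(** A slice is the adjoint of x |-> ten (dfwith y i x) applied to a vector F of
    Q.  Its tensor product with the x_j, j != i, is the image of F under the rank
    one operators of the other factors. *)
Lemma reach_slice i (x : vecs) s : slice i s -> reach (predC1 i) (ten (dfwith x i s)).
Proof.
pose Z := [set s : Hs i | forall x : vecs, reach (predC1 i) (ten (dfwith x i s))].
have cZ : closed_subspace Z.
  have -> : Z = \bigcap_(x in [set: vecs]) [set s | reach (predC1 i) (ten (dfwith x i s))].
    by apply/seteqP; split => z Zz y; [move=> _; exact: Zz|exact: (Zz y I)].
  apply: closed_subspace_bigI => y _.
  exact: (closed_subspace_preimage (bop_ten _ _ _) (closed_reach _)).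
suff : perp Z `<=` coslice i.
  by move=> /perpS; rewrite (perp_perp cZ) => sub ss; exact: sub ss x.
move=> r Zr y F QF.
have bJ := bop_ten H y i.
rewrite (adjE _ _ bJ); apply: Zr => {}x.
pose l := [seq j <- enum 'I_n | j != i].
have ul : uniq l by rewrite filter_uniq// enum_uniq.
have -> : ten (dfwith x i (adj (fun r => ten (dfwith y i r)) F)) = rank1s l x y F.
  apply: dot_ten_inj => f; rewrite rank1sE// dot_dfwithl adjEl//.
  rewrite big_filter big_enum_cond/= mulrC; congr (_ * dot F (ten _)).
  apply: functional_extensionality_dep => k; rewrite /override mem_filter mem_enum andbT.
  have [->|ki] := eqVneq k i; first by rewrite dfwithin.
  by rewrite dfwithout// eq_sym.
apply: reachS (reach_rank1s _ _ ul QF) => j /=.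
by rewrite mem_filter => /andP[].
Qed.

(** The image lies in [reach {i}] because only the i-th factor is touched, and
    in the [reach] of the complement because it is a limit of combinations of
    elementary tensors with i-th entry u. *)
Lemma rank1_Q i (u v : Hs i) F : slice i u -> Q F -> Q (rank1 u v F).
Proof.
move=> su QF; apply: (@reach_cap i).
  by apply: (@reach_rank1 pred0) => //=; exact: sub_reach.
move: (F); apply: ten_ind.
  exact: (closed_subspace_preimage (bop_rank1 H u v) (closed_reach _)).
move=> f /=; rewrite rank1_ten; apply: (closed_subspaceZ _ (closed_reach _)).
exact: reach_slice.
Qed.

(** Rank one operators with left vectors u_i send a vector F of Q to
    <F, ten v> ten u; if this vanishes for all F and v, then Q = 0 and the slices
    are trivial. *)
Lemma ten_slice (hn : (0 < n)%N) u : (forall i, slice i (u i)) -> Q (ten u).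
Proof.
move=> su.
have [[F [v [QF Fv]]]|no] := pselect (exists F v, Q F /\ dot F (ten v) != 0).
  have Qr : Q (rank1s (enum 'I_n) u v F).
    by elim: (enum 'I_n) => //= j l IH; exact: rank1_Q.
  have E : rank1s (enum 'I_n) u v F = dot F (ten v) *: ten u.
    apply: dot_ten_inj => f; rewrite rank1sE ?enum_uniq// dotZl tensor_dot mulrC.
    rewrite big_enum/=; congr (dot F (ten _) * _).
    by apply: functional_extensionality_dep => k; rewrite /override mem_enum.
  have -> : ten u = (dot F (ten v))^-1 *: (dot F (ten v) *: ten u).
    by rewrite scalerA mulVf// scale1r.
  by apply: (closed_subspaceZ _ Q_closed); rewrite -E.
have Q0 F : Q F -> F = 0.
  move=> QF; apply: dot_ten_inj => v; rewrite dot0l.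
  by apply/eqP; apply: contrapT => /negP Fv; apply: no; exists F, v.
pose i := Ordinal hn.
have ui : u i = 0.
  apply/eqP; rewrite -dot_eq0; apply/eqP; apply: su => y F /Q0 ->.
  exact: dot0r.
rewrite -(dfwith_id u i) ui (lin0 (bop_ten H u i).1).
by case: Q_closed.
Qed.

(** A vector G of Q has the same inner product with ten y and with the tensor
    product of the projections of the y_i, since replacing one entry by its
    projection changes the tensor by a vector orthogonal to Q. *)
Lemma doubly_commuting_tensor (hn : (0 < n)%N) :
  Q = tensor_subspace H slice.
Proof.
apply/seteqP; split; last first.
  apply: span_ind => //.
  by move=> _ [f sf <-]; exact: ten_slice.
set W := tensor_subspace H slice => F QF.
have cW : closed_subspace W by exact: closed_subspace_span.
have WQ : W `<=` Q by apply: span_ind => // _ [f sf <-]; exact: ten_slice.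
have [WF PF] := orth_projP F cW.
suff : F - orth_proj W F = 0 by move/eqP; rewrite subr_eq0 => /eqP ->.
set G := F - _.
have QG : Q G by apply: (closed_subspaceB Q_closed QF); exact: WQ.
apply: dot_ten_inj => y; rewrite dot0l.
pose p : vecs := fun i => orth_proj (slice i) (y i).
have cs i : closed_subspace (slice i) by exact: closed_subspace_perp.
have step l : dot G (ten (override l p y)) = dot G (ten y).
  elim: l => [//|j l <-]; set m := override l p y.
  have -> : override (j :: l) p y = dfwith m j (p j).
    apply: functional_extensionality_dep => k; rewrite /m /override inE.
    have [->|kj] /= := eqVneq k j; first by rewrite dfwithin.
    by rewrite dfwithout// eq_sym.
  rewrite -[in RHS](dfwith_id m j); apply/eqP.
  rewrite -subr_eq0 -dotBr -(linB (bop_ten H m j).1); apply/eqP; apply: dotC0.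
  have Pj : coslice j (p j - m j).
    have cc : closed_subspace (coslice j) by case: (coslice_submodule j).
    rewrite /m /override; case: ifP => _; first by rewrite subrr; case: cc.
    rewrite -opprB -scaleN1r; apply: (closed_subspaceZ _ cc).
    rewrite -(perp_perp cc); by case: (orth_projP (y j) (cs j)).
  exact: Pj.
rewrite -(step (enum 'I_n)); apply: PF; apply: sub_span; exists (override (enum 'I_n) p y) => //.
by move=> i; rewrite /override mem_enum; case: (orth_projP (y i) (cs i)).
Qed.

End Main.

(** * Tensor products of quotient modules are doubly commuting *)

Section Converse.
Context {R : realType} {n : nat} {Hs : 'I_n -> rkh_module R}.
Variable H : tensor_product Hs.
Local Notation ten := (tensor H).
Local Notation vecs := (forall i, Hs i).
Variable Qs : forall i, set (Hs i).
Arguments Qs : clear implicits.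
Hypothesis qQ : forall i, quotient_module1 (Qs i).
Local Notation Q := (tensor_subspace H Qs).

Lemma tensor_subspace_closed : closed_subspace Q.
Proof. exact: closed_subspace_span. Qed.

(** The inner product of two elementary tensors is a product over the factors,
    so projecting every entry gives the projection of the tensor. *)
Lemma orth_proj_ten (f : vecs) :
  orth_proj Q (ten f) = ten (fun i => orth_proj (Qs i) (f i)).
Proof.
have cQ i : closed_subspace (Qs i) by case: (qQ i).
apply: orth_proj_unique; first exact: tensor_subspace_closed.
  apply: sub_span; exists (fun i => orth_proj (Qs i) (f i)) => // i.
  by case: (orth_projP (f i) (cQ i)).
rewrite /tensor_subspace perp_span => _ [g Qg <-].
rewrite dotBl !tensor_dot; apply/eqP; rewrite subr_eq0; apply/eqP.
by apply: eq_bigr => i _; rewrite orth_proj_dotl.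
Qed.

Lemma tensor_doubly_commuting : quotient_module (tensor_mul H) Q ->
  doubly_commuting (tensor_mul H) Q.
Proof.
move=> hQ; apply/(doubly_commutingP hQ) => i j ij.
have cQ k : closed_subspace (Qs k) by case: (qQ k).
have bP := orth_proj_bop tensor_subspace_closed.
have bM k := bop_M H k; have bMs k := bop_Ms H k.
apply: span_ind.
  exact: (closed_subspace_eq (bop_comp bP (bop_comp (bM i) (bMs j)))
    (bop_comp (bMs j) (bop_comp bP (bM i)))).
move=> _ [q Qq <-] /=; have ji : j != i by rewrite eq_sym.
rewrite acts_Ms !acts_M !orth_proj_ten acts_Ms; congr (ten _).
apply: functional_extensionality_dep => k.
have [->|ki] := eqVneq k i.
  by rewrite dfwithin (dfwithout _ _ ji) (dfwithout _ _ ji) dfwithin.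
have ik : i != k by rewrite eq_sym.
rewrite (dfwithout _ _ ik); have [->|kj] := eqVneq k j.
  rewrite dfwithin dfwithin (dfwithout _ _ ij) [in RHS]orth_proj_id//.
  rewrite orth_proj_id//.
  by apply: (@quotient_adj _ _ _ (fun=> mulz (Hs j)) (Qs j) tt _ (bop_mulz _) (qQ j)).
have jk : j != k by rewrite eq_sym.
by rewrite !(dfwithout _ _ jk) (dfwithout _ _ ik).
Qed.

End Converse.

Theorem theorem4p7 (R : realType) (n : nat) (hn : (2 <= n)%N)
    (Hs : 'I_n -> rkh_module R) (H : tensor_product Hs)
    (hH : analytic_module H) (Q : set H)
    (hQ : quotient_module (tensor_mul H) Q) :
  doubly_commuting (tensor_mul H) Q <->
  exists Qs : forall i : 'I_n, set (Hs i),
    (forall i, quotient_module1 (Qs i)) /\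
    Q = tensor_subspace H Qs.
Proof.
split=> [dc|[Qs [qQ QE]]].
  exists (@slice _ _ _ H Q); split; first by move=> i; exact: slice_quotient.
  by apply: doubly_commuting_tensor => //; exact: ltnW.
by rewrite QE in hQ *; exact: tensor_doubly_commuting.
Qed.
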